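(* For every positive integer $h$ there are $\varepsilon_0=\varepsilon_0(h)>0$ and $d=d(h)$ with the following property. For every $2$-colorable oriented graph $H$ on $h$ vertices and every $0<\varepsilon<\varepsilon_0$ there is $n_0=n_0(\varepsilon)$ such that if a tournament $T$ on $n\ge n_0$ vertices is $\varepsilon$-far from being $H$-free, then $T$ contains at least $\varepsilon^d n^h$ copies of $H$.
   Context: An oriented graph is a directed graph without loops with at most one edge between any two distinct vertices. An oriented graph $H$ is $2$-colorable if $V(H)$ can be partitioned into $2$ sets each inducing an acyclic digraph. A tournament $T$ on $n$ vertices is $\varepsilon$-far from being $H$-free if one must reverse the direction of at least $\varepsilon n^2$ edges of $T$ to obtain a tournament containing no copy of $H$; a copy of $H$ in $T$ is a (not necessarily induced) subgraph of $T$ isomorphic to $H$. *)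

(* Defs.v *)
From mathcomp Require Import all_boot all_order all_algebra.
From mathcomp Require Import boolp reals.
Set Implicit Arguments. Unset Strict Implicit. Unset Printing Implicit Defensive.
Import Order.TTheory GRing.Theory Num.Theory.

Definition oriented (h : nat) (H : rel 'I_h) : Prop :=
  (forall x, ~~ H x x) /\ (forall x y, H x y -> ~~ H y x).

Definition tournament (n : nat) (T : rel 'I_n) : Prop :=
  (forall x, ~~ T x x) /\ (forall x y, x != y -> T x y (+) T y x).

(* The subdigraph induced by A is acyclic: it has no directed closed walk
   (equivalently, no directed cycle). *)
Definition acyclic_on (h : nat) (H : rel 'I_h) (A : {set 'I_h}) : Prop :=
  ~ exists (x : 'I_h) (s : seq 'I_h),
      [/\ x \in A, all (mem A) s, path H x s & H (last x s) x].

Definition two_colorable (h : nat) (H : rel 'I_h) : Prop :=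
  exists A : {set 'I_h}, acyclic_on H A /\ acyclic_on H (~: A).

Definition embedding (h n : nat) (H : rel 'I_h) (T : rel 'I_n) (f : 'I_h -> 'I_n) :=
  injective f /\ (forall u v, H u v -> T (f u) (f v)).

Definition H_free (h n : nat) (H : rel 'I_h) (T : rel 'I_n) : Prop :=
  ~ exists f, embedding H T f.

(* A copy of H in T: a (not necessarily induced) subgraph (vertex set, arc set)
   of T isomorphic to H, i.e. the image of an embedding. *)
Definition is_copy (h n : nat) (H : rel 'I_h) (T : rel 'I_n)
    (c : {set 'I_n} * {set 'I_n * 'I_n}) : Prop :=
  exists f, embedding H T f /\
    c = ([set f u | u : 'I_h], [set (f p.1, f p.2) | p in [set p : 'I_h * 'I_h | H p.1 p.2]]).

Definition num_copies (h n : nat) (H : rel 'I_h) (T : rel 'I_n) : nat :=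
  #|[set c | `[< is_copy H T c >]]|.

Definition num_reversed (n : nat) (T T' : rel 'I_n) : nat :=
  #|[set p : 'I_n * 'I_n | (p.1 < p.2)%N && (T p.1 p.2 != T' p.1 p.2)]|.

Local Open Scope ring_scope.
Definition eps_far (R : realType) (h n : nat) (H : rel 'I_h) (T : rel 'I_n) (eps : R) : Prop :=
  forall T' : rel 'I_n, tournament T' -> H_free H T' ->
    eps * (n%:R ^+ 2) <= (num_reversed T T')%:R.

(* Main.v *)
Require Import Defs.
From mathcomp Require Import all_boot all_order all_algebra.
From mathcomp Require Import boolp reals.
From mathcomp Require Import zify ring lra.
Set Implicit Arguments. Unset Strict Implicit. Unset Printing Implicit Defensive.
Import Order.TTheory GRing.Theory Num.Theory.

(** Let [q] be about [14 / eps] and call two vertices near when fewer than [n / q] vertices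
    tell them apart.  Remove greedily disjoint sets of [k] vertices ([k / n] polynomial in
    [1 / q]), each inside a ball, until every vertex has fewer than [k] near vertices left.

    If at least [n / q] vertices are left, then [p] random ones among them probably have
    distinct traces on [s = poly(q)] random vertices, even with [p > (s + 1) ^ m]; by
    Sauer-Shelah a bounded set is shattered.  Since every tournament on [2 ^ h] vertices
    contains a transitive one on [h] vertices, a large enough shattered set yields a copy of
    the 2-colorable [H], whatever the arcs inside the two sides.

    Otherwise pick a random representative in each of the [poly(q)] clusters, let the
    arcs between two clusters follow the representatives, and make each cluster transitive.
    On average this reverses few arcs, so at least half of the choices yield a copy of [H].
    Hence for some map of [H] to clusters with acyclic fibres, a polynomial fraction of
    the vertex tuples of [T] carries the quotient of [H]; by convexity so do its
    blow-ups, and transitive subtournaments of the blown-up classes restore [H]. *)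

(** * Sampling and ordering *)

Lemma card_family_prod (D V : finType) (F : D -> {set V}) :
  #|family (fun d => mem (F d))| = \prod_d #|F d|.
Proof. by rewrite card_family foldrE big_map big_enum. Qed.

(** Restricting a uniform member of the box [F] along an injective [g] gives a uniform member of the
    smaller box: the coordinates outside [codom g] stay free, so all fibres have the same size. *)
Lemma card_family_comp (D K V : finType) (F : D -> {set V}) (g : K -> D)
    (P : pred {ffun K -> V}) : injective g ->
  #|[set t in family (fun d => mem (F d)) | P [ffun k => t (g k)]]| * \prod_k #|F (g k)| =
  #|[set f in family (fun k => mem (F (g k))) | P f]| * \prod_d #|F d|.
Proof.
move=> gI.
have fib f : f \in family (fun k => mem (F (g k))) ->
    #|[set t in family (fun d => mem (F d)) | [ffun k => t (g k)] == f]|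
    = \prod_(d | d \notin codom g) #|F d|.
  move=> /familyP fF.
  (* The fibre over [f] is again a box: [G] pins coordinate [g k] to [f k]. *)
  pose G d := [set x in F d | [forall k, (g k == d) ==> (f k == x)]].
  have -> : [set t in family (fun d => mem (F d)) | [ffun k => t (g k)] == f]
      = [set t in family (fun d => mem (G d))].
    apply/setP=> t; rewrite !inE; apply/andP/familyP => [[/familyP tF /eqP fE] d|tG].
      rewrite inE; apply/andP; split; first exact: tF.
      by apply/forallP=> k; apply/implyP=> /eqP <-; rewrite -fE ffunE.
    split; first by apply/familyP=> d; have := tG d; rewrite !inE => /andP[].
    apply/eqP/ffunP=> k; rewrite ffunE; have := tG (g k).
    by rewrite !inE => /andP[_ /forallP/(_ k)]; rewrite eqxx => /eqP.
  rewrite cardsE card_family_prod (bigID (mem (codom g))) /= big1 ?mul1n.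
    apply: eq_bigr => d dg; congr #|pred_of_set _|; apply/setP=> x; rewrite !inE.
    case: (x \in F d) => //=; apply/forallP=> k; apply/implyP=> /eqP gk.
    by rewrite -gk codom_f in dg.
  move=> d /codomP[k ->]; apply/eqP/cards1P; exists (f k).
  apply/setP=> x; rewrite !inE; apply/andP/eqP => [[_ /forallP/(_ k)]|->].
    by rewrite eqxx => /eqP.
  split; first exact: fF.
  by apply/forallP=> k'; apply/implyP=> /eqP/gI ->.
have -> : \prod_d #|F d| = \prod_k #|F (g k)| * \prod_(d | d \notin codom g) #|F d|.
  rewrite (bigID (mem (codom g))) /=; congr (_ * _).
  rewrite -big_uniq; last exact/injectiveP.
  by rewrite big_map big_enum.
rewrite mulnCA mulnC; congr (_ * _).
rewrite -!sum1_card.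
rewrite (partition_big (fun t : {ffun D -> V} => [ffun k => t (g k)])
  [in [set f in family (fun k => mem (F (g k))) | P f]]) /=; last first.
  move=> t; rewrite !inE => /andP[/familyP tF Pt]; rewrite Pt andbT.
  by apply/familyP=> k; rewrite ffunE; apply: tF.
rewrite big_distrl /=; apply: eq_bigr => f; rewrite inE => /andP[fF Pf].
rewrite mul1n -(fib f fF) -sum1_card; apply: eq_bigl => t; rewrite !inE.
by case: eqP => [->|]; rewrite ?Pf ?andbT ?andbF.
Qed.

Lemma union_bound (I X : finType) (P : pred I) (A : {set X}) (B : I -> {set X}) :
  (forall x, x \in A -> exists2 i, P i & x \in B i) -> #|A| <= \sum_(i | P i) #|B i|.
Proof.
move=> AB; apply: (@leq_trans (\sum_(x in A) \sum_(i | P i) (x \in B i))).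
  rewrite -sum1_card; apply: leq_sum => x /AB[i Pi xi].
  by rewrite (bigD1 i) //= xi.
rewrite exchange_big /=; apply: leq_sum => i _.
rewrite -sum1_card big_mkcond [leqRHS]big_mkcond; apply: leq_sum => x _.
by case: (x \in A); case: (x \in B i).
Qed.

(** Converts samples containing a good tuple somewhere into a count of good tuples, by a union bound
    over the positions [g], each of which sees a uniform tuple. *)
Lemma sampling (D K V : finType) (F : D -> {set V}) (P : pred {ffun K -> V})
    (S : {set {ffun D -> V}}) (b : nat) :
  (forall d, b <= #|F d|) ->
  (forall t, t \in S -> t \in family (fun d => mem (F d)) /\
     exists2 g : K -> D, injective g & P [ffun k => t (g k)]) ->
  #|S| * b ^ #|K| <= #|D| ^ #|K| * #|[set f | P f]| * \prod_d #|F d|.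
Proof.
move=> bF SP.
have sub : #|S| <= \sum_(g : {ffun K -> D} | injectiveb g)
    #|[set t in family (fun d => mem (F d)) | P [ffun k => t (g k)]]|.
  apply: union_bound => t /SP[tF [g gI Pg]].
  exists [ffun k => g k].
    by apply/injectiveP=> x y; rewrite !ffunE => /gI.
  rewrite inE tF; congr (is_true (P _)): Pg.
  by apply/ffunP=> k; rewrite !ffunE.
apply: leq_trans (leq_mul sub (leqnn _)) _.
rewrite big_distrl /= -mulnA -card_ffun -sum_nat_const.
rewrite [leqRHS](bigID (fun g : {ffun K -> D} => injectiveb g)) /=.
apply: leq_trans (leq_addr _ _); apply: leq_sum => g /injectiveP gI.
have -> : b ^ #|K| = \prod_(k : K) b by rewrite prod_nat_const.
apply: (@leq_trans (#|[set t in family (fun d => mem (F d)) | P [ffun k => t (g k)]]|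
  * \prod_k #|F (g k)|)).
  by rewrite leq_mul2l leq_prod ?orbT // => k _; apply: bF.
rewrite card_family_comp // leq_mul2r; apply/orP; right.
by apply/subset_leq_card/subsetP=> f; rewrite !inE => /andP[].
Qed.

(** In the inductive step [A :\ x] has at least [2 ^ h.+1 - 1] elements, so [x] either dominates
    [2 ^ h] of them and goes first, or fails to dominate [2 ^ h] of them and goes last. *)
Lemma transitive_subtournament (V : finType) (T : rel V) (h : nat) (A : {set V}) :
  (forall x y, x != y -> T x y || T y x) -> 2 ^ h <= #|A| ->
  exists s : seq V, [/\ size s = h, {subset s <= A} & pairwise T s].
Proof.
move=> Ttot; elim: h A => [|h IH] A hA; first by exists [::].
have /card_gt0P[x xA] : 0 < #|A| by apply: leq_trans hA; rewrite expn_gt0.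
have AE : #|A| = (#|[set y in A :\ x | T x y]| + #|[set y in A :\ x | ~~ T x y]|).+1.
  rewrite (cardsD1 x) xA add1n; congr _.+1.
  rewrite -(cardsID [set y | T x y] (A :\ x)); congr (_ + _).
    by congr #|pred_of_set _|; apply/setP=> y; rewrite !inE.
  by congr #|pred_of_set _|; apply/setP=> y; rewrite !inE andbC.
have [h1|h1] := leqP (2 ^ h) #|[set y in A :\ x | T x y]|.
  have [s [ss sA sT]] := IH _ h1; exists (x :: s); split; first by rewrite /= ss.
    move=> y; rewrite inE => /orP[/eqP->//|/sA]; rewrite !inE.
    by case/andP=> /andP[].
  by rewrite /= sT andbT; apply/allP=> y /sA; rewrite inE => /andP[].
have h2 : 2 ^ h <= #|[set y in A :\ x | ~~ T x y]|.
  by move: hA; rewrite AE expnS; lia.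
have [s [ss sA sT]] := IH _ h2; exists (rcons s x); split.
- by rewrite size_rcons ss.
- move=> y; rewrite mem_rcons inE => /orP[/eqP->//|/sA]; rewrite !inE.
  by case/andP=> /andP[].
- rewrite pairwise_rcons sT andbT; apply/allP=> y /sA; rewrite !inE.
  by case/andP=> /andP[yx _]; have := Ttot _ _ yx; case: (T x y) => //; rewrite orbF.
Qed.

Lemma transitive_index (h : nat) (T : rel 'I_(2 ^ h)) :
  (forall x y, x != y -> T x y || T y x) ->
  exists c : {ffun 'I_h -> 'I_(2 ^ h)}, forall i j : 'I_h, i < j -> T (c i) (c j).
Proof.
move=> Ttot.
have [|s [ss _ /pairwiseP sT]] := @transitive_subtournament _ T h setT Ttot.
  by rewrite cardsT card_ord.
have x0 : 'I_(2 ^ h) by exists 0; rewrite expn_gt0.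
exists [ffun i : 'I_h => nth x0 s i] => i j ij; rewrite !ffunE.
by apply: sT; rewrite ?inE ?ss.
Qed.

Lemma ranking (h : nat) (k : 'I_h -> nat) :
  exists2 r : 'I_h -> 'I_h, injective r & forall u v, k u < k v -> r u < r v.
Proof.
(* Ties in [k] are broken by the index, which [k'] keeps as its residue modulo [h]. *)
pose k' (u : 'I_h) := k u * h + u.
have lt (u : 'I_h) : #|[set v | k' v < k' u]| < h.
  rewrite -[X in _ < X]card_ord -cardsT; apply: proper_card; apply/properP; split=> //.
  by exists u; rewrite // inE ltnn.
have mono u v : k' u < k' v -> Ordinal (lt u) < Ordinal (lt v).
  move=> uv /=; apply: proper_card; apply/properP; split.
    by apply/subsetP=> w; rewrite !inE => /ltn_trans; apply.
  by exists u; rewrite inE ?ltnn.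
exists (fun u => Ordinal (lt u)) => [u v uv|u v uv].
  have k'I : k' u = k' v.
    case: (ltngtP (k' u) (k' v)) => // /mono; first by rewrite uv ltnn.
    by rewrite -uv ltnn.
  have : k' u %% h = k' v %% h by rewrite k'I.
  by rewrite /k' !modnMDl !modn_small // => /val_inj.
apply: mono; rewrite /k'; have := ltn_ord u; have := ltn_ord v; nia.
Qed.

(** Vertices are ranked by their number of ancestors inside [A]. It grows along an arc, since
    otherwise the head would reach the tail and close a walk. *)
Lemma acyclic_ranking (h : nat) (H : rel 'I_h) (A : {set 'I_h}) : acyclic_on H A ->
  exists2 r : 'I_h -> 'I_h, injective r &
    forall u v, u \in A -> v \in A -> H u v -> r u < r v.
Proof.
move=> acA.
pose e u v := [&& u \in A, v \in A & H u v].
have [r rI rk] := ranking (fun u => #|[set w | connect e w u]|).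
exists r => // u v uA vA uv; apply: rk; apply: proper_card; apply/properP.
have euv : e u v by rewrite /e uA vA.
split; first by apply/subsetP=> w; rewrite !inE => /connect_trans; apply; exact: connect1.
exists v; rewrite !inE //; apply/negP=> /connectP[p pe ep].
apply: acA; exists v, p; split=> //; last by rewrite -ep.
  elim: p {ep} v {vA uv euv} pe => //= y p IH v /andP[/and3P[_ yA _] /IH]; by rewrite yA.
by apply: sub_path pe => x y /and3P[].
Qed.

(** * Shattered sets *)

Lemma tournament_total n (T : rel 'I_n) : tournament T ->
  forall x y, x != y -> T x y || T y x.
Proof. by case=> _ T2 x y /T2; case: (T x y) => //= ->. Qed.

Lemma increasing_injective (h : nat) (V : eqType) (T : rel V) (W : 'I_h -> V) :
  (forall x, ~~ T x x) -> (forall i j : 'I_h, i < j -> T (W i) (W j)) -> injective W.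
Proof.
move=> Tirr inc i j eqW; apply/val_inj.
by case: (ltngtP i j) => // /inc; rewrite eqW (negbTE (Tirr _)).
Qed.

(** The transitive order [c] of the vertices [u (e a)] is known only after the sets [e a] are fixed.
    So [Y] has blocks for every candidate [c], and there the sets prescribe the arcs of [H] as if
    [c] were the order. Arcs inside the two sides come from transitivity along acyclic rankings. *)
Lemma shattered_embedding (h n : nat) (H : rel 'I_h) (T : rel 'I_n)
    (Y := ({ffun 'I_h -> 'I_(2 ^ h)} * 'I_(2 ^ h).+1 * 'I_(2 ^ h) + 'I_(2 ^ h))%type)
    (u : {set Y} -> 'I_n) (z : Y -> 'I_n) :
  oriented H -> two_colorable H -> tournament T ->
  (forall e y, T (u e) (z y) = (y \in e)) ->
  exists f : 'I_h -> {set Y} + Y,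
    embedding H T (fun x => match f x with inl e => u e | inr y => z y end).
Proof.
move=> [Hirr Hor] [A [acA acB]] tT uz; have Ttot := tournament_total tT.
have Tirr := tT.1.
have zI : injective z.
  move=> y y' eqz; have := uz [set y] y'; rewrite -eqz uz !inE eqxx.
  by move/esym/eqP.
have [rA rAI rAH] := acyclic_ranking acA.
have [rB rBI rBH] := acyclic_ranking acB.
(* Each block of points [z] is ordered first, as this order does not depend on the sets [e a]. *)
have /fin_all_exists[t tP] (ck : {ffun 'I_h -> 'I_(2 ^ h)} * 'I_(2 ^ h).+1) :
    exists t : {ffun 'I_h -> 'I_(2 ^ h)},
    forall i j : 'I_h, i < j -> T (z (inl (ck, t i))) (z (inl (ck, t j))).
  apply: (@transitive_index _ (fun a b => T (z (inl (ck, a))) (z (inl (ck, b))))).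
  by move=> a b ab; apply: Ttot; apply: contra_neq ab => /zI[].
have tI ck : injective (t ck).
  by have := increasing_injective Tirr (tP ck) => I i j eqt; apply: I; rewrite eqt.
(* The tags [inr a'] make the sets [e a], hence the vertices [u (e a)], distinct. *)
pose e a : {set Y} := [set y : Y | match y with
  | inl (ck, b) => [exists x in A, exists y in ~: A,
      [&& ck.1 (rA x) == a, t ck (rB y) == b & H x y]]
  | inr a' => a' == a end].
have ueI : injective (fun a => u (e a)).
  move=> a b eqab; have := uz (e a) (inr a); rewrite eqab uz !inE eqxx.
  by move/eqP.
have [c cP] : exists c : {ffun 'I_h -> 'I_(2 ^ h)},
    forall i j : 'I_h, i < j -> T (u (e (c i))) (u (e (c j))).
  apply: (@transitive_index _ (fun a b => T (u (e a)) (u (e b)))).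
  by move=> a b ab; apply: Ttot; apply: contra_neq ab => /ueI.
have cI : injective c.
  by have := increasing_injective Tirr cP => I i j eqc; apply: I; rewrite eqc.
(* The [2 ^ h] vertices [u (e a)] meet at most [2 ^ h] of the [2 ^ h + 1] disjoint blocks. *)
have [k kP] : exists k, forall a b, u (e a) != z (inl (c, k, b)).
  apply: contrapT => nk.
  have /fin_all_exists[a aP] (k : 'I_(2 ^ h).+1) :
      exists a, exists b, u (e a) = z (inl (c, k, b)).
    apply: contrapT => na; apply: nk; exists k => a b; apply/eqP => eqab.
    by apply: na; exists a, b.
  have aI : injective a.
    move=> k k' eqa; have [b Eb] := aP k; have [b' Eb'] := aP k'.
    by move: Eb; rewrite eqa Eb' => /zI[].
  by have := leq_card a aI; rewrite !card_ord ltnn.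
have cross x y : x \in A -> y \notin A ->
    T (u (e (c (rA x)))) (z (inl (c, k, t (c, k) (rB y)))) = H x y.
  move=> xA yA; rewrite uz inE /=; apply/idP/idP => [|xy].
    case/existsP=> x' /andP[_ /existsP[y' /and4P[_ /eqP/cI/rAI <- /eqP/tI/rBI <-]]] //.
  apply/existsP; exists x; rewrite xA /=; apply/existsP; exists y.
  by rewrite inE yA !eqxx.
exists (fun x => if x \in A then inl (e (c (rA x)))
  else inr (inl (c, k, t (c, k) (rB x)))); split=> [x y|x y xy].
  case: ifP; case: ifP => _ _.
  - by move/ueI/cI/rAI.
  - by move/eqP; rewrite (negbTE (kP _ _)).
  - by move/esym/eqP; rewrite (negbTE (kP _ _)).
  - by move/zI => [] /tI/rBI.
case: ifPn => xA; case: ifPn => yA.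
- by apply: cP; apply: rAH.
- by rewrite cross.
(* For an arc of [H] into [A], the reverse arc is absent from [H], hence from [T] by [cross], so [T]
   has the wanted one. *)
- have := tT.2 _ _ (kP (c (rA y)) (t (c, k) (rB x))).
  by rewrite cross // (negbTE (Hor _ _ xy)).
- by apply: tP; apply: rBH; rewrite ?inE.
Qed.

Definition shatters (S : finType) (F : {set {set S}}) (B : {set S}) : bool :=
  [forall C : {set S}, (C \subset B) ==> [exists X in F, X :&: B == C]].

Lemma shattersP (S : finType) (F : {set {set S}}) (B : {set S}) :
  reflect (forall C : {set S}, C \subset B -> exists2 X, X \in F & X :&: B = C) (shatters F B).
Proof.
apply: (iffP forallP) => FB C.
  move=> CB; have /implyP/(_ CB)/existsP[X /andP[XF /eqP <-]] := FB C.
  by exists X.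
apply/implyP=> /FB[X XF <-]; apply/existsP; exists X; by rewrite XF eqxx.
Qed.

(* Pajor's strengthening of the Sauer-Shelah lemma, which makes the induction work. *)
Lemma leq_card_shattered (S : finType) (F : {set {set S}}) :
  #|F| <= #|[set B | shatters F B]|.
Proof.
have [m] := ubnP #|F|; elim: m F => // m IH F Fm.
have [F1|F1] := leqP #|F| 1.
  have [->|[X XF]] := set_0Vmem F; first by rewrite cards0.
  apply: leq_trans F1 _; apply/card_gt0P; exists set0; rewrite inE; apply/shattersP=> C.
  by rewrite subset0 => /eqP->; exists X; rewrite // setI0.
have [X [X' [XF X'F XX']]] := card_gt1P F1.
have [x xXX'] : exists x, (x \in X) != (x \in X').
  apply/existsP; apply: contraNT XX'; rewrite negb_exists => /forallP XX'.
  by apply/eqP/setP=> x; apply/eqP; have := XX' x; rewrite negbK.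
wlog [xX xX'] : X X' XF X'F {XX' xXX'} / x \in X /\ x \notin X'.
  move=> W; case E : (x \in X) xXX' => /=; case E' : (x \in X') => //= _.
    by apply: (W X X'); rewrite ?E ?E'.
  by apply: (W X' X); rewrite ?E ?E'.
pose F1' := [set Z in F | x \in Z]; pose F0 := [set Z in F | x \notin Z].
have FE : #|F| = #|F1'| + #|F0|.
  rewrite -(cardsID [set Z : {set S} | x \in Z] F); congr (_ + _).
    by congr #|pred_of_set _|; apply/setP=> Z; rewrite !inE.
  by congr #|pred_of_set _|; apply/setP=> Z; rewrite !inE andbC.
have F1p : 0 < #|F1'| by apply/card_gt0P; exists X; rewrite inE XF.
have F0p : 0 < #|F0| by apply/card_gt0P; exists X'; rewrite inE X'F.
have IH1 := IH F1' ltac:(lia); have IH0 := IH F0 ltac:(lia).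
have nx (G : {set {set S}}) (B : {set S}) b :
    (forall Z : {set S}, Z \in G -> (x \in Z) = b) -> shatters G B -> x \notin B.
  move=> Gb /shattersP GB; apply/negP=> xB.
  have [Z ZG ZE] := GB [set x] ltac:(by rewrite sub1set).
  have [Z' Z'G Z'E] := GB set0 (sub0set _).
  have := in_set1 x x; rewrite -ZE eqxx inE xB andbT Gb // => b1.
  by have := in_set0 x; rewrite -Z'E inE xB andbT Gb // b1.
have nx1 B : shatters F1' B -> x \notin B.
  by apply: (nx _ _ true) => Z; rewrite inE => /andP[].
have nx0 B : shatters F0 B -> x \notin B.
  by apply: (nx _ _ false) => Z; rewrite inE => /andP[_ /negbTE].
set S1 := [set B | shatters F1' B] in IH1; set S0 := [set B | shatters F0 B] in IH0.
rewrite FE; apply: leq_trans (leq_add IH1 IH0) _.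
(* A set [B] shattered by both halves counts twice on the left; it is paid for by [B] and [x |: B],
   the latter being new because no set shattered by a half contains [x]. *)
rewrite -cardsUI -(card_in_imset (f := fun B => x |: B) (D := mem (S1 :&: S0))); last first.
  move=> B B'; rewrite !inE => /andP[/nx1 xB _] /andP[/nx1 xB' _] eqB.
  by rewrite -(setU1K xB) eqB setU1K.
rewrite -cardsUI [X in _ + X](_ : _ = 0) ?addn0; last first.
  apply/eqP; rewrite cards_eq0; apply/eqP/setP=> B; rewrite !inE.
  apply/negP=> /andP[B1 /imsetP[B' _ EB]].
  have : x \notin B by case/orP: B1 => [/nx1|/nx0].
  by rewrite EB setU11.
have mono (G : {set {set S}}) (B : {set S}) : G \subset F -> shatters G B -> shatters F B.
  move=> /subsetP GF /shattersP GB; apply/shattersP=> C /GB[Z /GF ZF ZE].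
  by exists Z.
apply/subset_leq_card/subsetP=> B; rewrite !inE => /orP[/orP[]|].
- by apply: mono; apply/subsetP=> Z; rewrite inE => /andP[].
- by apply: mono; apply/subsetP=> Z; rewrite inE => /andP[].
case/imsetP=> B'; rewrite !inE => /andP[B1 B0] ->; apply/shattersP=> C CB.
have xB' := nx1 _ B1.
have sub : C :\ x \subset B'.
  by apply/subsetP=> y; rewrite !inE => /andP[yx /(subsetP CB)]; rewrite !inE (negbTE yx).
have [xC|xC] := boolP (x \in C).
  have [Z ZF ZE] := shattersP _ _ B1 _ sub.
  move: ZF; rewrite inE => /andP[ZF xZ]; exists Z => //.
  by rewrite setIUr ZE (setIidPr _) ?sub1set // setD1K.
have [Z ZF ZE] := shattersP _ _ B0 _ sub.
move: ZF; rewrite inE => /andP[ZF xZ]; exists Z => //.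
rewrite setIUr ZE [Z :&: _](_ : _ = set0) ?set0U.
  by apply/setP=> y; rewrite !inE; case: eqP => [->|]; rewrite ?(negbTE xC).
by apply/setP=> y; rewrite !inE; case: eqP => [->|]; rewrite ?andbF ?(negbTE xZ).
Qed.

(** A set is encoded by a list of its elements, padded with [None] to length [m]. *)
Lemma leq_card_small_sets (S : finType) (m : nat) :
  #|[set B : {set S} | #|B| <= m]| <= #|S|.+1 ^ m.
Proof.
rewrite -[X in X ^ _]card_option -[X in _ ^ X]card_ord -card_ffun -cardsT.
apply: leq_trans (leq_imset_card (fun f : {ffun 'I_m -> option S} =>
  [set y | Some y \in codom f]) _); apply/subset_leq_card/subsetP=> B; rewrite inE => Bm.
apply/imsetP; exists [ffun i : 'I_m => nth None (map Some (enum B)) i] => //.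
apply/setP=> y; rewrite inE; apply/idP/codomP => [yB|[i]].
  have iy : index y (enum B) < m.
    by apply: leq_trans Bm; rewrite cardE index_mem mem_enum.
  exists (Ordinal iy); rewrite ffunE /= (nth_map y) ?nth_index ?index_mem ?mem_enum //.
rewrite ffunE; case: (ltnP i #|B|) => iB.
  by rewrite (nth_map y) -?cardE // => -[->]; rewrite -mem_enum mem_nth -?cardE.
by rewrite nth_default // size_map -cardE.
Qed.

(** Sets of at most [#|Y|] points are too few to be all the shattered ones, so a larger set is
    shattered; [g] labels part of it by [Y]. *)
Lemma sauer_shelah (S Y : finType) (F : {set {set S}}) :
  #|S|.+1 ^ #|Y| < #|F| -> exists g : Y -> S,
    forall e : {set Y}, exists2 X, X \in F & forall y, (g y \in X) = (y \in e).
Proof.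
move=> FS.
have [B FB BY] : exists2 B, shatters F B & #|Y| <= #|B|.
  have : ~~ ([set B | shatters F B] \subset [set B : {set S} | #|B| <= #|Y|]).
    apply/negP=> /subset_leq_card; apply/negP; rewrite -ltnNge.
    apply: leq_ltn_trans (leq_card_small_sets _ _) _.
    exact: leq_trans FS (leq_card_shattered _).
  by case/subsetPn=> B; rewrite !inE -ltnNge => FB /ltnW; exists B.
pose g y : S := enum_val (widen_ord BY (enum_rank y)).
have gI : injective g.
  by move=> y y' /enum_val_inj/(congr1 val)/= E; apply: enum_rank_inj; apply: val_inj.
exists g => e; have [|X XF XE] := shattersP _ _ FB (g @: e).
  by apply/subsetP=> _ /imsetP[y _ ->]; apply: enum_valP.
exists X => // y; rewrite -(mem_imset (mem e) y gI) -XE inE.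
by rewrite (enum_valP (widen_ord BY (enum_rank y))) andbT.
Qed.

(** * Clusters and random samples *)

Lemma embedding_ext h n (H : rel 'I_h) (T : rel 'I_n) f g :
  f =1 g -> embedding H T f -> embedding H T g.
Proof. by move=> /funext ->. Qed.

Definition embeddings h n (H : rel 'I_h) (T : rel 'I_n) : {set {ffun 'I_h -> 'I_n}} :=
  [set f : {ffun 'I_h -> 'I_n} | `[< embedding H T f >]].

(** Embeddings with the same copy as image all map into its [h] vertices, so there are at most
    [h ^ h] of them. *)
Lemma leq_embeddings_copies h n (H : rel 'I_h) (T : rel 'I_n) :
  #|embeddings H T| <= num_copies H T * h ^ h.
Proof.
pose cp (f : {ffun 'I_h -> 'I_n}) := ([set f u | u : 'I_h],
  [set (f p.1, f p.2) | p in [set p : 'I_h * 'I_h | H p.1 p.2]]).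
rewrite /num_copies -sum_nat_const.
pose B (c : {set 'I_n} * {set 'I_n * 'I_n}) : {set {ffun 'I_h -> 'I_n}} :=
  [set f in embeddings H T | cp f == c].
apply: leq_trans (union_bound (B := B) (P := mem [set c | `[< is_copy H T c >]]) _) _.
  move=> f fE; exists (cp f); last by rewrite !inE eqxx; move: fE; rewrite inE => ->.
  by move: fE; rewrite !inE => /asboolP fE; apply/asboolP; exists f.
apply: leq_sum => c /=; rewrite inE => /asboolP[f [[fI _] ->]].
set c1 := [set f u | u : 'I_h].
have c1h : #|c1| = h by rewrite card_imset // card_ord.
rewrite -[X in X ^ _]c1h -[X in _ ^ X]card_ord -card_ffun_on.
apply/subset_leq_card/subsetP=> g; rewrite !inE => /andP[_ /eqP[gc _]].
apply/ffun_onP=> x; have : g x \in [set g u | u : 'I_h] by apply: imset_f.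
by rewrite gc.
Qed.

Lemma exists_subset_card (V : finType) (A : {set V}) k : k <= #|A| ->
  exists2 B : {set V}, B \subset A & #|B| = k.
Proof.
move=> kA; exists [set x in take k (enum A)].
  by apply/subsetP=> x; rewrite inE => /mem_take; rewrite mem_enum.
rewrite cardsE (card_uniqP _) ?take_uniq ?enum_uniq //.
by rewrite size_takel // -cardE.
Qed.

(** [P] is an inclusion-maximal family of disjoint clusters: [k] uncovered vertices near one [v]
    would form a further cluster. *)
Lemma maximal_clustering (V : finType) (near : rel V) k : 0 < k ->
  exists P : {set {set V}}, [/\ trivIset P,
    forall B, B \in P -> #|B| = k /\ exists c, forall v, v \in B -> near c v &
    forall v, #|[set u in ~: cover P | near v u]| < k].
Proof.
move=> k0; pose ok (P : {set {set V}}) := trivIset P &&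
  [forall B in P, (#|B| == k) && [exists c, forall v in B, near c v]].
have [|P /maxsetP[/andP[tP /forallP okP] maxP]] := @ex_maxset _ ok.
  exists set0; apply/andP; split; first by apply/trivIsetP=> A B; rewrite inE.
  by apply/forallP=> B; rewrite inE.
exists P; split=> // [B BP|v].
  have := okP B; rewrite BP /= => /andP[/eqP-> /existsP[c /forallP cB]]; split=> //.
  by exists c => v vB; have := cB v; rewrite vB.
rewrite ltnNge; apply/negP=> /exists_subset_card[B BS Bk].
have Bv w : w \in B -> w \notin cover P /\ near v w.
  by move/(subsetP BS); rewrite !inE => /andP[].
have [w wB] : exists w, w \in B by apply/card_gt0P; rewrite Bk.
have /maxP E : ok (B |: P).
  apply/andP; split; last first.
    apply/forallP=> A; rewrite in_setU1; apply/implyP=> /orP[/eqP->|AP].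
      rewrite Bk eqxx /=; apply/existsP; exists v; apply/forallP=> x.
      by apply/implyP=> /Bv[].
    by have := okP A; rewrite AP.
  rewrite setUC; apply: trivIsetU => //; first exact: trivIset1.
  rewrite /cover big_set1 disjoint_sym disjoint_subset; apply/subsetP=> x /Bv[+ _].
  by rewrite inE.
have BP : B \in P by rewrite -E ?subsetUr // setU11.
have [/negP[]] := Bv w wB; apply/bigcupP; by exists B.
Qed.

(** * Distinct traces of random vertices *)

Definition distance (V : finType) (T : rel V) (a b : V) := #|[set z | T a z != T b z]|.

Lemma distance_triangle (V : finType) (T : rel V) a b c :
  distance T a b <= distance T c a + distance T c b.
Proof.
apply: leq_trans (leq_card_setU _ _); apply/subset_leq_card/subsetP=> z.
by rewrite !inE; case: (T a z); case: (T b z); case: (T c z).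
Qed.

Definition trace (V : finType) (T : rel V) p s (t : {ffun 'I_p + 'I_s -> V}) (i : 'I_p) :=
  [set y : 'I_s | T (t (inl i)) (t (inr y))].

Definition sample_range (V : finType) (U : {set V}) p s (d : 'I_p + 'I_s) : {set V} :=
  if d is inl _ then U else setT.
Arguments sample_range {V} U p s d.

Lemma sample_range_prod (V : finType) (U : {set V}) p s :
  \prod_d #|sample_range U p s d| = #|U| ^ p * #|V| ^ s.
Proof. by rewrite big_sumType /= !prod_nat_const !card_ord cardsT. Qed.

Lemma leq_exp_base m n e : m <= n -> m ^ e <= n ^ e.
Proof. by case: e => // e mn; rewrite leq_exp2r. Qed.

(** Fix the vertices [a], [b] drawn at [i], [j]. Equal traces force all [s] test vertices into the
    agreement set [G a b]. Near pairs have probability at most [k / #|U|]; for a far pair each test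
    vertex lands in [G a b] with probability at most [1 - 1 / q]. *)
Lemma card_equal_traces (V : finType) (T : rel V) (U : {set V}) q k p s (i j : 'I_p) :
  i != j -> 0 < q ->
  (forall v, #|[set u in U | q * distance T v u < #|V|]| <= k) ->
  #|[set t in family (fun d => mem (sample_range U p s d)) | trace T t i == trace T t j]|
    * (#|U| * q ^ s) <= (k * q ^ s + #|U| * q.-1 ^ s) * (#|U| ^ p * #|V| ^ s).
Proof.
move=> ij q0 Uk; set n := #|V|; set bad := [set t in _ | _].
pose G a b := [set z | T a z == T b z].
pose Fab (ab : V * V) (d : 'I_p + 'I_s) : {set V} := match d with
  | inl l => if l == i then [set ab.1] else if l == j then [set ab.2] else U
  | inr _ => G ab.1 ab.2 end.
pose Z := \prod_(l : 'I_p | (l != i) && (l != j)) #|U|.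
have UZ : #|U| ^ p = #|U| * (#|U| * Z).
  rewrite -[X in _ ^ X]card_ord -prod_nat_const (bigD1 i) //= (bigD1 j) //=.
  by rewrite eq_sym.
have bound : #|bad| <= \sum_(ab | (ab.1 \in U) && (ab.2 \in U)) Z * #|G ab.1 ab.2| ^ s.
  apply: leq_trans (union_bound (I := (V * V)%type)
    (P := fun ab : V * V => (ab.1 \in U) && (ab.2 \in U))
    (B := fun ab => [set t in family (fun d => mem (Fab ab d))]) _) _.
    move=> t; rewrite inE => /andP[/familyP tF /eqP tij].
    exists (t (inl i), t (inl j)); first by rewrite /= (tF (inl i)) (tF (inl j)).
    rewrite inE; apply/familyP=> -[l|y] /=.
      case: eqP => [->|_]; first by rewrite inE.
      by case: eqP => [->|_]; [rewrite inE|apply: (tF (inl l))].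
    by rewrite inE; move/setP: tij => /(_ y); rewrite !inE => ->.
  apply: leq_sum => ab _; rewrite cardsE card_family_prod big_sumType /=.
  rewrite prod_nat_const card_ord leq_mul2r; apply/orP; right.
  rewrite (bigD1 i) //= eqxx cards1 mul1n (bigD1 j) /=; last by rewrite eq_sym.
  rewrite eq_sym (negbTE ij) eqxx cards1 mul1n; apply: leq_prod => l /andP[li lj].
  by rewrite (negbTE li) (negbTE lj).
have GE a b : #|G a b| + distance T a b = n.
  rewrite /n -(cardsC (G a b)); congr (_ + _); congr #|pred_of_set _|.
  by apply/setP=> z; rewrite !inE.
(* The first summand is the trivial bound for near pairs, the second the decay for far ones. *)
have Gs a b : #|G a b| ^ s * q ^ s <=
    (q * distance T a b < n) * (n ^ s * q ^ s) + q.-1 ^ s * n ^ s.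
  have := GE a b; case: ltnP => [_|far] Gab; rewrite ?mul1n ?mul0n -!expnMn.
    apply: leq_trans (leq_addr _ _); apply: leq_exp_base; nia.
  apply: leq_exp_base; nia.
have {}bound := leq_mul bound (leqnn (#|U| * q ^ s)).
apply: leq_trans bound _; rewrite UZ.
have -> : (k * q ^ s + #|U| * q.-1 ^ s) * (#|U| * (#|U| * Z) * n ^ s) =
  \sum_(a in U) (Z * #|U| * (k * (n ^ s * q ^ s) + #|U| * (q.-1 ^ s * n ^ s))).
  by rewrite sum_nat_const; nia.
rewrite big_distrl /= -(pair_big (mem U) (mem U) (fun a b => Z * #|G a b| ^ s * (#|U| * q ^ s))) /=.
apply: leq_sum => a _.
apply: (@leq_trans (\sum_(b in U) Z * #|U| *
   ((q * distance T a b < n) * (n ^ s * q ^ s) + q.-1 ^ s * n ^ s))).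
  apply: leq_sum => b _; rewrite -mulnA -[leqRHS]mulnA leq_mul2l; apply/orP; right.
  by rewrite mulnCA leq_mul2l Gs orbT.
rewrite -big_distrr leq_mul2l /= big_split /= sum_nat_const leq_add2r; apply/orP; right.
rewrite -big_distrl leq_mul2r /=; apply/orP; right.
apply: leq_trans (Uk a); rewrite -sum1_card big_mkcond [leqRHS]big_mkcond.
by apply: leq_sum => b _; rewrite inE; case: (b \in U).
Qed.

(** Union bound over [p ^ 2] pairs: the two error terms of [card_equal_traces] are each at most
    [1 / (4 * p ^ 2)], so a collision has probability at most one half. *)
Lemma leq_distinct_traces (V : finType) (T : rel V) (U : {set V}) q k p s :
  0 < q -> 0 < #|U| -> 4 * p ^ 2 * k <= #|U| -> 4 * p ^ 2 * q.-1 ^ s <= q ^ s ->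
  (forall v, #|[set u in U | q * distance T v u < #|V|]| <= k) ->
  #|U| ^ p * #|V| ^ s <= 2 * #|[set t in family (fun d => mem (sample_range U p s d)) |
    injectiveb (trace T t)]|.
Proof.
move=> q0 U0 kU qs Uk; set N := #|U| ^ p * #|V| ^ s; set good := [set t in _ | _].
pose bad := [set t in family (fun d => mem (sample_range U p s d)) |
  ~~ injectiveb (trace T t)].
have NE : N = #|good| + #|bad|.
  have -> : N = #|[set t in family (fun d => mem (sample_range U p s d))]|.
    by rewrite cardsE card_family_prod sample_range_prod.
  rewrite -(cardsID [set t : {ffun 'I_p + 'I_s -> V} | injectiveb (trace T t)]); congr (_ + _).
    by congr #|pred_of_set _|; apply/setP=> t; rewrite !inE.
  by congr #|pred_of_set _|; apply/setP=> t; rewrite !inE andbC.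
suff : 2 * #|bad| <= N by lia.
have cu : 0 < #|U| * q ^ s by rewrite muln_gt0 U0 expn_gt0 q0.
have sub : #|bad| * (#|U| * q ^ s) <= p ^ 2 * ((k * q ^ s + #|U| * q.-1 ^ s) * N).
  have -> : p ^ 2 = #|{: 'I_p * 'I_p}| by rewrite card_prod !card_ord mulnn.
  rewrite -[leqRHS]sum_nat_const.
  pose B (ij : 'I_p * 'I_p) := [set t in family (fun d => mem (sample_range U p s d)) |
    trace T t ij.1 == trace T t ij.2].
  have ub : #|bad| <= \sum_(ij | ij.1 != ij.2) #|B ij|.
    apply: union_bound => t; rewrite inE => /andP[tF /injectivePn[i [j ij tij]]].
    by exists (i, j); rewrite // inE tF /= tij eqxx.
  apply: leq_trans (leq_mul ub (leqnn _)) _.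
  rewrite big_distrl /= [leqRHS](bigID (fun ij => ij.1 != ij.2)) /=.
  apply: leq_trans (leq_addr _ _); apply: leq_sum => -[i j] /= ij.
  exact: card_equal_traces.
rewrite -(leq_pmul2r cu) -mulnA -(leq_pmul2l (isT : 0 < 2)).
apply: leq_trans (_ : 4 * (p ^ 2 * ((k * q ^ s + #|U| * q.-1 ^ s) * N)) <= _).
  by rewrite mulnA leq_mul2l sub orbT.
have := leq_mul kU (leqnn (q ^ s)); have := leq_mul (leqnn #|U|) qs.
rewrite -/N => h1 h2.
have h3 : 4 * p ^ 2 * (k * q ^ s + #|U| * q.-1 ^ s) <= 2 * (#|U| * q ^ s) by lia.
by have := leq_mul h3 (leqnn N); lia.
Qed.

(** [p] exceeds the Sauer-Shelah bound for [s] points by one. Hence half of the samples shatter a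
    copy of the index set [Y] of [shattered_embedding] and contain [H], and [sampling] counts the
    embeddings. *)
Lemma embeddings_of_sparse_set h n (H : rel 'I_h) (T : rel 'I_n) (U : {set 'I_n}) q k s
    (m := #|{: {ffun 'I_h -> 'I_(2 ^ h)} * 'I_(2 ^ h).+1 * 'I_(2 ^ h) + 'I_(2 ^ h)}|)
    (p := (s.+1 ^ m).+1) :
  oriented H -> two_colorable H -> tournament T ->
  0 < q -> 0 < #|U| -> 4 * p ^ 2 * k <= #|U| -> 4 * p ^ 2 * q.-1 ^ s <= q ^ s ->
  (forall v, #|[set u in U | q * distance T v u < n]| <= k) -> n <= q * #|U| ->
  n ^ h <= 2 * (q * (p + s)) ^ h * #|embeddings H T|.
Proof.
move=> oH H2 tT q0 U0 kU qs Uk nU.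
have := @leq_distinct_traces _ T U q k p s q0 U0 kU qs; rewrite card_ord => /(_ Uk).
set S := [set t in _ | _] => Sbig.
have n0 : 0 < n by apply: leq_trans U0 _; rewrite -[X in _ <= X]card_ord max_card.
have Ub d : #|U| <= #|@sample_range 'I_n U p s d|.
  by case: d => [l|y] /=; rewrite ?cardsT // max_card.
have emb t : t \in S -> t \in family (fun d => mem (sample_range U p s d)) /\
    exists2 g : 'I_h -> 'I_p + 'I_s, injective g & `[< embedding H T [ffun k => t (g k)] >].
  rewrite inE => /andP[tF /injectiveP tI]; split=> //.
  have [|g gP] := @sauer_shelah 'I_s
      ({ffun 'I_h -> 'I_(2 ^ h)} * 'I_(2 ^ h).+1 * 'I_(2 ^ h) + 'I_(2 ^ h))%type
      [set trace T t i | i : 'I_p].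
    by rewrite card_imset // !card_ord.
  have /fin_all_exists[i iP] (e : {set _}) : exists i, forall y, (g y \in trace T t i) = (y \in e).
    by have [_ /imsetP[i _ ->] iP] := gP e; exists i.
  have [|f fE] := @shattered_embedding h n H T (fun e => t (inl (i e)))
    (fun y => t (inr (g y))) oH H2 tT.
    by move=> e y; rewrite -iP inE.
  exists (fun x => match f x with inl e => inl (i e) | inr y => inr (g y) end).
    by move=> x x' eqx; apply: (fE.1); case: (f x) eqx; case: (f x') => // ? ? [->].
  by apply/asboolP; apply: embedding_ext fE => x; rewrite ffunE; case: (f x).
have := @sampling _ 'I_h _ _ (fun f => `[< embedding H T f >]) S #|U| Ub emb.
rewrite sample_range_prod card_sum !card_ord -/(embeddings H T) => b.
have N0 : 0 < #|U| ^ p * n ^ s by rewrite muln_gt0 !expn_gt0 U0 n0.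
have Uh : #|U| ^ h <= 2 * (p + s) ^ h * #|embeddings H T|.
  rewrite -(leq_pmul2r N0); move: {Sbig}(leq_mul Sbig (leqnn (#|U| ^ h))) b.
  move: (#|U| ^ h) (_ ^ p * _) #|S| ((p + s) ^ h) #|embeddings H T| => a N x y z; lia.
apply: (@leq_trans ((q * #|U|) ^ h)); first exact: leq_exp_base.
by rewrite !expnMn; have := leq_mul (leqnn (q ^ h)) Uh; lia.
Qed.

(** Union bound over pairs of coordinates, each colliding with probability [1 / #|V|]. *)
Lemma card_noninjective (D V : finType) :
  #|[set t : {ffun D -> V} | ~~ injectiveb t]| * #|V| <= #|D| ^ 2 * #|V| ^ #|D|.
Proof.
have pair (x y : D) : x != y -> #|[set t : {ffun D -> V} | t x == t y]| * #|V| <= #|V| ^ #|D|.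
  move=> xy; pose Z := \prod_(d : D | (d != x) && (d != y)) #|V|.
  have VZ : #|V| ^ #|D| = #|V| * (#|V| * Z).
    by rewrite -prod_nat_const (bigD1 x) //= (bigD1 y) //= eq_sym.
  pose Fa a (d : D) : {set V} := if d == x then [set a] else if d == y then [set a] else setT.
  rewrite VZ mulnC leq_mul2l -sum_nat_const; apply/orP; right.
  apply: leq_trans (union_bound (P := mem V)
    (B := fun a => [set t in family (fun d => mem (Fa a d))]) _) _.
    move=> t; rewrite inE => /eqP txy; exists (t x) => //; rewrite inE; apply/familyP=> d.
    rewrite /Fa; case: eqP => [->|_]; first by rewrite inE.
    by case: eqP => [->|_]; rewrite inE ?txy.
  apply: leq_sum => a _; rewrite cardsE card_family_prod /Fa.
  rewrite (bigD1 x) //= eqxx cards1 mul1n (bigD1 y) /=; last by rewrite eq_sym.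
  rewrite eq_sym (negbTE xy) eqxx cards1 mul1n; apply: leq_prod => d /andP[dx dy].
  by rewrite (negbTE dx) (negbTE dy) cardsT.
have -> : #|D| ^ 2 = #|{: D * D}| by rewrite card_prod mulnn.
rewrite -[leqRHS]sum_nat_const.
pose B (xy : D * D) := [set t : {ffun D -> V} | t xy.1 == t xy.2].
set bad := [set t | _]; have ub : #|bad| <= \sum_(xy | xy.1 != xy.2) #|B xy|.
  apply: union_bound => t; rewrite inE => /injectivePn[x [y xy txy]].
  by exists (x, y); rewrite // inE /= txy.
apply: leq_trans (leq_mul ub (leqnn _)) _.
rewrite big_distrl /= [leqRHS](bigID (fun xy => xy.1 != xy.2)) /=.
by apply: leq_trans (leq_addr _ _); apply: leq_sum => -[x y] /=; apply: pair.
Qed.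

(** * Blow-ups *)

Local Open Scope ring_scope.

(** Induction multiplies the bound by [x]; the surplus is [M.+1%:R * a ^+ M * (x - a) ^+ 2]. *)
Lemma power_tangent (R : realFieldType) (x a : R) M : 0 <= x -> 0 <= a ->
  a ^+ M.+1 + M.+1%:R * a ^+ M * (x - a) <= x ^+ M.+1.
Proof.
move=> x0 a0; elim: M => [|M IH]; first by rewrite !expr1 expr0; lra.
have h1 := ler_wpM2l x0 IH.
have h2 : 0 <= M.+1%:R * a ^+ M * (x - a) ^+ 2.
  by apply: mulr_ge0 (sqr_ge0 _); apply: mulr_ge0 (exprn_ge0 _ a0).
have -> : M.+2%:R = M.+1%:R + 1 :> R by rewrite -[M.+2]addn1 natrD.
rewrite ![_ ^+ M.+2]exprS; apply: le_trans h1; rewrite -subr_ge0.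
rewrite ![_ ^+ M.+1]exprS in h2 *; apply: le_trans h2 _.
by rewrite le_eqVlt; apply/orP; left; apply/eqP; ring.
Qed.

(** Jensen for powers, by summing the tangents at [a]: their linear terms have a nonnegative sum. *)
Lemma power_mean (R : realFieldType) (I : finType) (x : I -> R) (a : R) M :
  0 <= a -> (forall i, 0 <= x i) -> #|I|%:R * a <= \sum_i x i ->
  #|I|%:R * a ^+ M <= \sum_i x i ^+ M.
Proof.
case: M => [|M] a0 x0 xa.
  by rewrite expr0 mulr1 (eq_bigr (fun=> 1)) ?sumr_const.
apply: le_trans (_ : \sum_i (a ^+ M.+1 + M.+1%:R * a ^+ M * (x i - a)) <= _); last first.
  by apply: ler_sum => i _; apply: power_tangent.
rewrite big_split /= sumr_const -[X in _ <= X + _]mulr_natl lerDl -mulr_sumr.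
apply: mulr_ge0; first by apply: mulr_ge0 (exprn_ge0 _ a0).
by rewrite sumrB sumr_const -[X in _ - X]mulr_natl subr_ge0.
Qed.

Definition fcons (B : finType) j (b : B) (g : {ffun 'I_j -> B}) : {ffun 'I_j.+1 -> B} :=
  [ffun i => oapp g b (unlift ord0 i)].

Lemma fcons0 (B : finType) j (b : B) (g : {ffun 'I_j -> B}) : fcons b g ord0 = b.
Proof. by rewrite ffunE unlift_none. Qed.

Lemma fconsS (B : finType) j (b : B) (g : {ffun 'I_j -> B}) i : fcons b g (lift ord0 i) = g i.
Proof. by rewrite ffunE liftK. Qed.

Lemma fcons_eta (B : finType) j (w : {ffun 'I_j.+1 -> B}) :
  fcons (w ord0) [ffun i => w (lift ord0 i)] = w.
Proof.
by apply/ffunP=> i; case: (unliftP ord0 i) => [i' ->|->]; rewrite ?fcons0 ?fconsS ?ffunE.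
Qed.

Lemma sum_fcons (B : finType) j (F : {ffun 'I_j.+1 -> B} -> nat) :
  (\sum_w F w = \sum_b \sum_g F (fcons b g))%N.
Proof.
rewrite pair_big /= (reindex (fun p : B * {ffun 'I_j -> B} => fcons p.1 p.2)) //=.
exists (fun w => (w ord0, [ffun i => w (lift ord0 i)])) => [[b g] _|w _] /=.
  by rewrite fcons0; congr (_, _); apply/ffunP=> i; rewrite ffunE fconsS.
exact: fcons_eta.
Qed.

(** Homomorphic images of the complete [j]-partite hypergraph with parts of size [M]: [W i] lists
    [M] candidates, possibly repeated, for coordinate [i]. *)
Definition blowup (B : finType) M j (Q : pred {ffun 'I_j -> B}) :
    pred {ffun 'I_j -> {ffun 'I_M -> B}} :=
  fun W => [forall a : {ffun 'I_j -> 'I_M}, Q [ffun i => W i (a i)]].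
Arguments blowup {B} M {j} Q W.

Lemma blowup_fcons (B : finType) M j (Q : pred {ffun 'I_j.+1 -> B}) W0 W :
  blowup M Q (fcons W0 W) = [forall a, blowup M (fun g => Q (fcons (W0 a) g)) W].
Proof.
have E (a : 'I_M) (f : {ffun 'I_j -> 'I_M}) :
    [ffun i => fcons W0 W i (fcons a f i)] = fcons (W0 a) [ffun i => W i (f i)].
  by apply/ffunP=> i; case: (unliftP ord0 i) => [i' ->|->]; rewrite ffunE ?fcons0 ?fconsS ?ffunE.
apply/forallP/forallP => [Q1 a|Q1 f].
  by apply/forallP=> f; rewrite -E.
by rewrite -(fcons_eta f) E; apply: (forallP (Q1 (f ord0))).
Qed.

(** Once the later lists [W] are fixed, the [M] entries of the first list are chosen independently,
    whence the power [M]. *)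
Lemma card_blowup_fcons (B : finType) M j (Q : pred {ffun 'I_j.+1 -> B}) :
  (#|[set W | blowup M Q W]| =
   \sum_(W : {ffun 'I_j -> {ffun 'I_M -> B}})
     (\sum_b blowup M (fun g => Q (fcons b g)) W) ^ M)%N.
Proof.
rewrite -sum1dep_card big_mkcond /= sum_fcons exchange_big /=; apply: eq_bigr => W _.
rewrite -[X in (_ ^ X)%N]card_ord -prod_nat_const bigA_distr_bigA /=.
apply: eq_bigr => W0 _; rewrite blowup_fcons; case: (boolP [forall a, _]) => [/forallP all1|].
  by rewrite big1 // => a _; rewrite all1.
by case/forallPn=> a /negbTE na; rewrite (bigD1 a) //= na.
Qed.

(** Counting form of the theorem of Erdős on complete [j]-partite hypergraphs. Convexity is used
    twice: over [b], for the densities [x b] of the links given to the induction hypothesis, and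
    over [W], for the power [M] of [card_blowup_fcons]. *)
Lemma blowup_density (R : realFieldType) (B : finType) M j (Q : pred {ffun 'I_j -> B}) (d : R) :
  0 <= d -> (0 < #|B|)%N -> d * #|B|%:R ^+ j <= #|[set w | Q w]|%:R ->
  d ^+ (M ^ j) * #|B|%:R ^+ (M * j) <= #|[set W | blowup M Q W]|%:R.
Proof.
elim: j Q d => [|j IH] Q d d0 B0.
  rewrite muln0 expn0 !expr0 expr1 => /le_trans; apply; rewrite ler_nat.
  pose e (w : {ffun 'I_0 -> B}) : {ffun 'I_0 -> {ffun 'I_M -> B}} := [ffun i => [ffun=> w i]].
  have e0 (C : finType) (w w' : {ffun 'I_0 -> C}) : w = w' by apply/ffunP=> -[].
  have eI : injective e by move=> w w' _; apply: e0.
  rewrite -(card_imset _ eI).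
  apply/subset_leq_card/subsetP=> W /imsetP[w]; rewrite inE => Qw ->; rewrite inE.
  by apply/forallP=> a; rewrite (e0 B [ffun _ => _] w).
move=> dQ; have B0' : 0 < #|B|%:R :> R by rewrite ltr0n.
pose Qb b := [set g | Q (fcons b g)]; pose x b : R := #|Qb b|%:R / #|B|%:R ^+ j.
have x0 b : 0 <= x b by rewrite divr_ge0 ?exprn_ge0 ?ler0n.
have QE : #|[set w | Q w]| = (\sum_b #|Qb b|)%N.
  rewrite -sum1dep_card big_mkcond /= sum_fcons; apply: eq_bigr => b _.
  by rewrite -sum1dep_card [RHS]big_mkcond.
have xsum : #|B|%:R * d <= \sum_b x b.
  rewrite -mulr_suml ler_pdivlMr ?exprn_gt0 // -natr_sum -QE.
  by apply: le_trans dQ; rewrite exprS mulrA (mulrC d).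
have {}xsum := power_mean (M ^ j) d0 x0 xsum.
rewrite card_blowup_fcons natr_sum.
under eq_bigr do rewrite natrX.
have -> : d ^+ (M ^ j.+1) * #|B|%:R ^+ (M * j.+1) =
    #|{ffun 'I_j -> {ffun 'I_M -> B}}|%:R * (#|B|%:R * d ^+ (M ^ j)) ^+ M :> R.
  rewrite !card_ffun !card_ord !natrX exprMn -!exprM expnSr mulnS exprD.
  by ring.
apply: power_mean => //; first by apply: mulr_ge0 (exprn_ge0 _ d0).
rewrite -natr_sum exchange_big /= natr_sum !card_ffun !card_ord !natrX -exprM.
apply: le_trans (ler_wpM2l _ xsum) _; first by rewrite exprn_ge0 ?ler0n.
rewrite mulr_sumr; apply: ler_sum => b _; rewrite mulrC.
apply: le_trans (IH (fun g => Q (fcons b g)) (x b) (x0 b) B0 _) _.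
  by rewrite /x divfK // expf_neq0 ?gt_eqF.
by rewrite ler_nat -sum1dep_card big_mkcond /=; apply: leq_sum => W _; case: blowup.
Qed.

Lemma blowup_count (B : finType) M j (Q : pred {ffun 'I_j -> B}) E :
  (0 < #|B| -> 0 < E -> #|B| ^ j <= E * #|[set w | Q w]| ->
  #|B| ^ (M * j) <= E ^ (M ^ j) * #|[set W | blowup M Q W]|)%N.
Proof.
move=> B0 E0 QE; have E0' : 0 < E%:R :> rat by rewrite ltr0n.
have := @blowup_density rat B M j Q (E%:R^-1) _ B0 _; rewrite invr_ge0 ler0n => /(_ isT).
rewrite ler_pdivrMl // -natrX -natrM ler_nat => /(_ QE).
by rewrite exprVn ler_pdivrMl ?exprn_gt0 // -!natrX -natrM ler_nat.
Qed.

Local Close Scope ring_scope.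

(** * Rounding to a cluster tournament *)

Lemma tournament_neg n (T : rel 'I_n) x y : tournament T -> x != y -> T x y = ~~ T y x.
Proof. by case=> _ /[apply]; case: (T x y); case: (T y x). Qed.

(** Following the index order inside a cluster makes the part of [H] embedded there acyclic. *)
Definition cluster_tournament n (I : eqType) (T : rel 'I_n) (cls : 'I_n -> I) (w : I -> 'I_n) :
    rel 'I_n :=
  fun u v => if cls u == cls v then u < v else T (w (cls u)) (w (cls v)).

Lemma cluster_tournamentP n (I : eqType) (T : rel 'I_n) cls (w : I -> 'I_n) :
  tournament T -> (forall i, cls (w i) = i) -> tournament (cluster_tournament T cls w).
Proof.
move=> tT clsw; rewrite /cluster_tournament; split=> [x|x y xy]; first by rewrite eqxx ltnn.
rewrite [cls y == _]eq_sym; case: eqP => [_|/eqP cxy].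
  by case: ltngtP => // /val_inj/eqP; rewrite (negbTE xy).
by apply: tT.2; apply: contra_neq cxy => /(congr1 cls); rewrite !clsw.
Qed.

(** * Average number of reversed arcs *)

Section Clusters.

Variables (n : nat) (I : finType) (T : rel 'I_n) (F : I -> {set 'I_n}) (cls : 'I_n -> I).
Variables (q k : nat).
Hypothesis tT : tournament T.
Hypothesis clsF : forall i v, v \in F i -> cls v = i.
Hypothesis cardF : forall i, #|F i| = k.
Hypothesis diamF : forall i a b, a \in F i -> b \in F i -> q * distance T a b <= 2 * n.

(** [cls] is total, so an unclustered vertex has an arbitrary class; it is recognised by lying
    outside the cluster of that class. *)
Local Notation U := [set v | v \notin F (cls v)].
Local Notation fam := [set w : {ffun I -> 'I_n} | w \in family (fun i => mem (F i))].

Lemma representative_mem w : w \in fam -> forall i, w i \in F i.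
Proof. by rewrite inE => /familyP. Qed.

(** Errors of the second of two replacements: [u] has already given way to its representative, and
    now [v] gives way to [w (cls v)]. *)
Definition exchanged := [set x : {ffun I -> 'I_n} * 'I_n * 'I_n | let: (w, u, v) := x in
  [&& w \in fam, u \in F (cls u), v \in F (cls v), cls u != cls v &
    T v (w (cls u)) != T (w (cls v)) (w (cls u))]].

(* Swapping [u] with the representative [w (cls u)] preserves the uniform measure on
   triples and turns the bound on [T v _] against [T (w (cls v)) _] into a distance. *)
Lemma card_exchanged : q * #|exchanged| <= #|fam| * (n * (2 * n)).
Proof.
pose sw (x : {ffun I -> 'I_n} * 'I_n * 'I_n) : {ffun I -> 'I_n} * 'I_n * 'I_n :=
  let: (w, u, v) := x in ([ffun i => if i == cls u then u else w i], w (cls u), v).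
have swK : {in exchanged, cancel sw sw}.
  move=> [[w u] v]; rewrite inE /= => /and5P[wF uF _ _ _].
  have -> : cls (w (cls u)) = cls u by apply/clsF/representative_mem.
  rewrite ffunE eqxx; congr (_, _, _); apply/ffunP=> i; rewrite !ffunE.
  by case: eqP => [->|].
rewrite -(card_in_imset (can_in_inj swK)).
pose X := [set x : {ffun I -> 'I_n} * 'I_n * 'I_n | let: (w, u, v) := x in
  [&& w \in fam, v \in F (cls v) & T v u != T (w (cls v)) u]].
apply: (@leq_trans (q * #|X|)).
  rewrite leq_mul2l; apply/orP; right; apply/subset_leq_card/subsetP=> x /imsetP[[[w u] v]].
  rewrite inE => /and5P[wF uF vF uv Tne] ->; rewrite inE /= vF /=; apply/andP; split.
    rewrite inE; apply/familyP=> i; rewrite ffunE; case: eqP => [->|_]; first exact: uF.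
    exact: representative_mem.
  by rewrite ffunE [cls v == _]eq_sym (negbTE uv).
pose B (wv : {ffun I -> 'I_n} * 'I_n) := [set x : {ffun I -> 'I_n} * 'I_n * 'I_n |
  [&& x.1.1 == wv.1, x.2 == wv.2 & T wv.2 x.1.2 != T (wv.1 (cls wv.2)) x.1.2]].
have ub : #|X| <= \sum_(wv | (wv.1 \in fam) && (wv.2 \in F (cls wv.2))) #|B wv|.
  apply: union_bound => -[[w u] v]; rewrite inE => /and3P[wF vF Tne].
  by exists (w, v); rewrite /= ?wF ?vF // inE /= !eqxx.
apply: leq_trans (leq_mul (leqnn q) ub) _; rewrite big_distrr /=.
apply: (@leq_trans
  (\sum_(wv : {ffun I -> 'I_n} * 'I_n | (wv.1 \in fam) && (wv.2 \in F (cls wv.2))) 2 * n)).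
  apply: leq_sum => -[w v] /= /andP[wF vF].
  apply: leq_trans (diamF vF (representative_mem wF (cls v))); rewrite leq_mul2l; apply/orP; right.
  apply: leq_trans (leq_imset_card (fun z => (w, z, v)) _).
  apply/subset_leq_card/subsetP=> -[[w' u] v']; rewrite inE /= => /and3P[/eqP-> /eqP-> Tne].
  by apply: imset_f; rewrite inE.
rewrite sum_nat_const [leqRHS]mulnA leq_mul2r.
have -> : #|fam| * n = #|setX fam [set: 'I_n]| by rewrite cardsX cardsT card_ord.
apply/orP; right; apply/subset_leq_card/subsetP=> -[w v].
by rewrite unfold_in /= => /andP[wF _]; rewrite in_setX in_setT wF.
Qed.

(** A reversed pair has an unclustered end ([X1], [X2]), lies in one cluster ([X3]), or changes when
    [u] ([X4]) and then [v] ([X5]) is replaced by its representative. *)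
Lemma num_reversed_cluster w : w \in fam ->
  q * num_reversed T (cluster_tournament T cls w) <=
  2 * q * #|U| * n + q * k * n + 2 * n ^ 2 +
  q * #|[set uv | (w, uv.1, uv.2) \in exchanged]|.
Proof.
move=> wF; have wi := representative_mem wF.
pose X1 := setX U [set: 'I_n]; pose X2 := setX [set: 'I_n] U.
pose X3 := [set uv : 'I_n * 'I_n | uv.2 \in F (cls uv.1)].
pose X4 := [set uv : 'I_n * 'I_n | (uv.1 \in F (cls uv.1)) &&
  (T uv.1 uv.2 != T (w (cls uv.1)) uv.2)].
set X5 := [set uv | (w, uv.1, uv.2) \in exchanged].
have sub : num_reversed T (cluster_tournament T cls w) <=
    #|X1| + #|X2| + #|X3| + #|X4| + #|X5|.
  have cU (A B : {set 'I_n * 'I_n}) m : #|A| <= m -> #|A :|: B| <= m + #|B|.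
    move=> Am; apply: leq_trans (leq_card_setU _ _) _; by rewrite leq_add2r.
  apply: leq_trans (_ : #|X1 :|: X2 :|: X3 :|: X4 :|: X5| <= _); last by do 4!apply: (cU).
  apply/subset_leq_card/subsetP=> -[u v]; rewrite !in_setU inE /= => /andP[uv Tne].
  rewrite !in_setX !inE /= !andbT.
  have [uF|//] := boolP (u \in F (cls u)); have [vF|//] /= := boolP (v \in F (cls v)).
  move: Tne; rewrite /cluster_tournament; case: (cls u =P cls v) => [cuv _|/eqP cuv Tne].
    by rewrite cuv vF.
  case: (T u v =P T (w (cls u)) v) => [E|]; last by rewrite orbT.
  have -> /= : [forall i, w i \in mem (F i)] by apply/forallP.
  apply/orP; right; apply: contraNneq Tne => E2.
  rewrite E; have clsw i : cls (w i) = i by apply: clsF.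
  rewrite (@tournament_neg _ _ _ v tT) ?E2; last by apply: contra_neq cuv => <-; rewrite clsw.
  by rewrite -tournament_neg //; apply: contra_neq cuv => /(congr1 cls); rewrite !clsw.
have h3 : #|X3| <= k * n.
  rewrite mulnC -[n in n * k]card_ord -sum_nat_const.
  apply: leq_trans (union_bound (P := xpredT) (B := fun u => setX [set u] (F (cls u))) _) _.
    by move=> [u v]; rewrite inE /= => vF; exists u; rewrite // in_setX set11.
  by apply: leq_sum => u _; rewrite cardsX cards1 mul1n cardF.
have h4 : q * #|X4| <= n * (2 * n).
  pose B u := setX [set u] [set v | T u v != T (w (cls u)) v].
  have ub : #|X4| <= \sum_(u | u \in F (cls u)) #|B u|.
    apply: union_bound => -[u v]; rewrite inE /= => /andP[uF Tne].
    by exists u; rewrite // in_setX set11 inE.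
  apply: leq_trans (leq_mul (leqnn q) ub) _; rewrite big_distrr /= -[n in n * _]card_ord.
  rewrite -sum_nat_const [leqRHS](bigID (fun u => u \in F (cls u))) /=.
  apply: leq_trans (leq_addr _ _); apply: leq_sum => u uF.
  by rewrite cardsX cards1 mul1n; apply: diamF (wi _).
have h1 : #|X1| = #|U| * n by rewrite cardsX cardsT card_ord.
have h2 : #|X2| = #|U| * n by rewrite cardsX cardsT card_ord mulnC.
apply: leq_trans (leq_mul (leqnn q) sub) _; rewrite h1 h2 mulnDr.
rewrite leq_add2r; have := leq_mul (leqnn q) h3; lia.
Qed.

Lemma sum_num_reversed_cluster : q * #|U| <= n -> q * k <= n ->
  \sum_(w in fam) q * num_reversed T (cluster_tournament T cls w) <= 7 * n ^ 2 * #|fam|.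
Proof.
move=> qU qk.
apply: leq_trans (leq_sum _ (fun w => @num_reversed_cluster w)) _.
rewrite big_split /= sum_nat_const -big_distrr /=.
have -> : \sum_(w in fam) #|[set uv | (w, uv.1, uv.2) \in exchanged]| = #|exchanged|.
  rewrite -[RHS]sum1_card (partition_big (fun x => x.1.1) (mem fam)) /=; last first.
    by move=> [[w u] v]; rewrite inE => /and5P[].
  apply: eq_bigr => w _.
  have inj : injective (fun uv : 'I_n * 'I_n => (w, uv.1, uv.2)) by move=> [u v] [u' v'] [-> ->].
  rewrite -(card_imset _ inj) -sum1_card; apply: eq_bigl => -[[w' u] v] /=.
  apply/imsetP/andP => [[[u' v']]|[xE /eqP <-]].
    by rewrite inE => xE [-> -> ->].
  by exists (u, v); first rewrite in_set.
(* The factor 7 is 2 for unclustered ends, 1 for pairs inside clusters and 2 for each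
   replacement. *)
have := card_exchanged; have := leq_mul qU (leqnn n); have := leq_mul qk (leqnn n).
move: #|exchanged| => e h1 h2 h3.
have h4 : 2 * q * #|U| * n + q * k * n + 2 * (n * n) <= 5 * (n * n).
  by move: h1 h2 {qU}; move: #|U| => x; lia.
rewrite -mulnn; have := leq_mul (leqnn #|fam|) h4; move: h3; move: #|fam| #|U| => f x; lia.
Qed.

End Clusters.

(** * Quotients of [H] and their blow-ups *)

(** The fibres of [p] are the parts of [H] sent to a common cluster; [r] witnesses that all of them
    are acyclic. Labelling clusters by ['I_h] leaves only [h ^ h] maps [p], however many clusters
    there are. *)
Definition quotient_embedding h n (H : rel 'I_h) (T : rel 'I_n)
    (p : 'I_h -> 'I_h) (f : 'I_h -> 'I_n) : Prop :=
  (exists2 r : 'I_h -> 'I_h, injective r & forall u v, H u v -> p u = p v -> r u < r v) /\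
  (forall u v, H u v -> p u != p v -> T (f (p u)) (f (p v))).

(** Listing the image of [s] before the rest of [I] puts its at most [h] values at positions below
    [h]. *)
Lemma factor_through_injection h (I : finType) (s : 'I_h -> I) : 0 < h -> h <= #|I| ->
  exists (g : 'I_h -> I) (p : 'I_h -> 'I_h), injective g /\ forall u, g (p u) = s u.
Proof.
move=> h0 hI; pose S := [set s u | u : 'I_h]; pose l := enum S ++ enum (~: S).
have i0 := s (Ordinal h0).
have ul : uniq l.
  rewrite cat_uniq !enum_uniq andbT /=; apply/hasPn=> x.
  by rewrite !mem_enum inE.
have sl : size l = #|I| by rewrite size_cat -!cardE cardsC.
have il u : index (s u) l < h.
  have sS : s u \in enum S by rewrite mem_enum imset_f.
  rewrite index_cat sS; apply: (@leq_trans (size (enum S))); first by rewrite index_mem.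
  by rewrite -cardE -[X in _ <= X]card_ord; apply: leq_imset_card.
exists (fun i => nth i0 l i), (fun u => Ordinal (il u)); split=> [i j|u].
  by move/eqP; rewrite nth_uniq ?sl ?(leq_trans (ltn_ord _) hI) // => /eqP/val_inj.
by rewrite /= nth_index // -index_mem sl; apply: leq_trans (il u) hI.
Qed.

(** Inside a cluster arcs increase the index, so ranking by [f u] shows that the fibres are
    acyclic. *)
Lemma quotient_of_cluster_embedding h n (H : rel 'I_h) (T : rel 'I_n) (I : finType)
    (cls : 'I_n -> I) (w : {ffun I -> 'I_n}) (f : 'I_h -> 'I_n) :
  0 < h -> h <= #|I| -> embedding H (cluster_tournament T cls w) f ->
  exists (p : {ffun 'I_h -> 'I_h}) (g : 'I_h -> I), injective g /\
    quotient_embedding H T p [ffun k => w (g k)].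
Proof.
move=> h0 hI [_ fH]; have [g [p [gI gp]]] := factor_through_injection (fun u => cls (f u)) h0 hI.
have [r rI rf] := ranking (fun u => f u).
exists [ffun u => p u], g; split=> //; split=> [|u v uv].
  exists r => // u v uv; rewrite !ffunE => puv; apply: rf; have := fH _ _ uv.
  by rewrite /cluster_tournament -!gp puv eqxx.
rewrite !ffunE => puv; have := fH _ _ uv; rewrite /cluster_tournament -!gp.
by rewrite (inj_eq gI) (negbTE puv).
Qed.

Lemma pigeonhole_sum (I X : finType) (P : pred X) (Q : I -> pred X) :
  0 < #|I| -> (forall x, P x -> exists i, Q i x) ->
  exists i, #|[set x | P x]| <= #|I| * #|[set x | Q i x]|.
Proof.
move=> /card_gt0P[i0 _] PQ; case: (@arg_maxnP _ i0 xpredT (fun i => #|[set x | Q i x]|)) => //.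
move=> i _ imax; exists i; rewrite -sum_nat_const.
apply: leq_trans (union_bound (P := xpredT) (B := fun i => [set x | Q i x]) _) _.
  by move=> x; rewrite inE => /PQ[j Qj]; exists j; rewrite // inE.
by apply: leq_sum => j _; apply: imax.
Qed.

(** A choice of representatives without [H] costs [14 * n ^ 2 / q] reversals, twice the average
    bound, so at least half of the choices yield [H]. Then [sampling] and a pigeonhole over [p]
    apply. *)
Lemma frequent_quotient h n (H : rel 'I_h) (T : rel 'I_n) (I : finType)
    (F : I -> {set 'I_n}) (cls : 'I_n -> I) q k :
  tournament T -> (forall i v, v \in F i -> cls v = i) -> (forall i, #|F i| = k) ->
  (forall i a b, a \in F i -> b \in F i -> q * distance T a b <= 2 * n) ->
  q * #|[set v | v \notin F (cls v)]| <= n -> q * k <= n ->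
  (forall T' : rel 'I_n, tournament T' -> H_free H T' -> 14 * n ^ 2 <= q * num_reversed T T') ->
  0 < h -> h <= #|I| -> 0 < k -> 0 < n ->
  exists p : {ffun 'I_h -> 'I_h}, k ^ h <= 2 * #|I| ^ h * h ^ h *
    #|[set f : {ffun 'I_h -> 'I_n} | `[< quotient_embedding H T p f >]]|.
Proof.
move=> tT clsF cardF diamF qU qk far h0 hI k0 n0.
set fam := [set w : {ffun I -> 'I_n} | w \in family (fun i => mem (F i))].
pose S := [set w in fam | ~~ `[< H_free H (cluster_tournament T cls w) >]].
pose S' := [set w in fam | `[< H_free H (cluster_tournament T cls w) >]].
have famE : #|fam| = k ^ #|I|.
  by rewrite cardsE card_family_prod (eq_bigr (fun=> k)) // prod_nat_const.
have clsw w : w \in fam -> forall i, cls (w i) = i.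
  by rewrite inE => /familyP wF i; apply: clsF; apply: wF.
have SE : #|fam| = #|S| + #|S'|.
  rewrite -(cardsID [set w : {ffun I -> 'I_n} | ~~ `[< H_free H (cluster_tournament T cls w) >]]).
  congr (_ + _); congr #|pred_of_set _|; apply/setP=> w.
    by rewrite /fam /S !inE.
  by rewrite /fam /S' !inE negbK andbC.
have S'fam : #|S'| * (14 * n ^ 2) <= 7 * n ^ 2 * #|fam|.
  apply: leq_trans (sum_num_reversed_cluster tT clsF cardF diamF qU qk).
  rewrite -sum_nat_const [leqRHS](big_setID S') /= -/fam.
  have -> : fam :&: S' = S' by apply/setIidPr/subsetP=> w; rewrite inE => /andP[].
  apply: leq_trans (leq_addr _ _); apply: leq_sum => w; rewrite inE => /andP[wF /asboolP].
  by apply: far; apply: cluster_tournamentP => // i; apply: clsw.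
have Sbig : k ^ #|I| <= 2 * #|S|.
  have : 2 * #|S'| <= #|fam|.
    rewrite -(@leq_pmul2r (7 * n ^ 2)); last by rewrite muln_gt0 expn_gt0 n0.
    by move: S'fam; move: (n ^ 2) #|S'| #|fam| => x y z; lia.
  by rewrite -famE; lia.
pose P (f : {ffun 'I_h -> 'I_n}) :=
  [exists p : {ffun 'I_h -> 'I_h}, `[< quotient_embedding H T p f >]].
have kF i : k <= #|F i| by rewrite cardF.
have SP t : t \in S -> t \in family (fun i => mem (F i)) /\
    exists2 g : 'I_h -> I, injective g & P [ffun x => t (g x)].
  rewrite inE => /andP[tF /asboolPn nfree]; split; first by move: tF; rewrite inE.
  have [f fE] : exists f, embedding H (cluster_tournament T cls t) f by apply: contrapT.
  have [p [g [gI pg]]] := quotient_of_cluster_embedding h0 hI fE.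
  by exists g => //; apply/existsP; exists p; apply/asboolP.
have := sampling kF SP; rewrite (eq_bigr (fun=> k)) // prod_nat_const card_ord => sam.
have [|f /existsP[p fp]|p pP] := @pigeonhole_sum {ffun 'I_h -> 'I_h} _ P
    (fun p f => `[< quotient_embedding H T p f >]).
- by rewrite card_ffun card_ord expn_gt0 h0.
- by exists p.
exists p; move: pP; rewrite card_ffun !card_ord => pP.
have kI : 0 < k ^ #|I| by rewrite expn_gt0 k0.
have arith a b c d e X Y : Y <= d * X -> e * b <= a * Y * c -> c * b <= 2 * e * b ->
    b * c <= 2 * a * d * X * c.
  by move=> /(leq_mul (leqnn (a * c))); lia.
rewrite -(leq_pmul2r kI); apply: arith pP sam _.
exact: leq_mul Sbig (leqnn _).
Qed.

(** Each class of [2 ^ h] vertices contains a transitive tournament on [h] of them; [u] takes place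
    [r u] in class [p u]. *)
Lemma embedding_of_blowup h n (H : rel 'I_h) (T : rel 'I_n) (p : 'I_h -> 'I_h)
    (W : {ffun 'I_h * 'I_(2 ^ h) -> 'I_n}) :
  tournament T -> injective W ->
  blowup (2 ^ h) (fun f : {ffun 'I_h -> 'I_n} => `[< quotient_embedding H T p f >])
    [ffun i => [ffun a => W (i, a)]] ->
  exists2 g : 'I_h -> 'I_h * 'I_(2 ^ h), injective g & embedding H T (fun x => W (g x)).
Proof.
move=> tT WI /forallP bW.
have Q a : quotient_embedding H T p (fun i => W (i, a i)).
  have /asboolP := bW [ffun i => a i]; congr quotient_embedding.
  by apply/funext=> i; rewrite !ffunE.
(* The ranking concerns [H] and [p] only, so the selection of first candidates serves as well as
   any. *)
have [r rI rH] := (Q (fun i => Ordinal (expn_gt0 2 h))).1.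
have /fin_all_exists[c cP] (i : 'I_h) : exists c : {ffun 'I_h -> 'I_(2 ^ h)},
    forall x y : 'I_h, x < y -> T (W (i, c x)) (W (i, c y)).
  apply: (@transitive_index _ (fun a b => T (W (i, a)) (W (i, b)))) => a b ab.
  by apply: tournament_total tT _ _ _; apply: contra_neq ab => /WI[].
have cI i : injective (c i).
  by have := increasing_injective tT.1 (cP i) => J x y cxy; apply: J; rewrite cxy.
exists (fun u => (p u, c (p u) (r u))).
  by move=> u v [-> /cI/rI].
split=> [u v /WI[puv]|u v uv]; first by rewrite puv => /cI/rI.
have [puv|puv] := eqVneq (p u) (p v).
  by rewrite puv; apply: cP; apply: rH.
have := (Q (fun i => if i == p u then c (p u) (r u) else c (p v) (r v))).2 u v uv puv.
by rewrite eqxx eq_sym (negbTE puv).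
Qed.

(** The lower bound on [n] makes non-injective tuples at most half of the guaranteed number of
    blow-ups. *)
Lemma embeddings_of_quotient h n (H : rel 'I_h) (T : rel 'I_n) (p : 'I_h -> 'I_h) E
    (M := 2 ^ h) :
  tournament T -> 0 < h -> 0 < E -> 2 * (h * M) ^ 2 * E ^ (M ^ h) <= n ->
  n ^ h <= E * #|[set f : {ffun 'I_h -> 'I_n} | `[< quotient_embedding H T p f >]]| ->
  n ^ h <= 2 * E ^ (M ^ h) * (h * M) ^ h * #|embeddings H T|.
Proof.
move=> tT h0 E0; set E' := E ^ (M ^ h) => nE.
pose Q (f : {ffun 'I_h -> 'I_n}) := `[< quotient_embedding H T p f >]; rewrite -/Q => nQ.
have hM0 : 0 < h * M by rewrite muln_gt0 h0 expn_gt0.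
have E'0 : 0 < E' by rewrite expn_gt0 E0.
have n0 : 0 < n by apply: leq_trans nE; rewrite muln_gt0 E'0 andbT muln_gt0 expn_gt0 hM0.
have cn : #|'I_n| = n by rewrite card_ord.
have := @blowup_count 'I_n M h Q E; rewrite cn => /(_ n0 E0 nQ) bQ.
pose curry (W : {ffun 'I_h * 'I_M -> 'I_n}) : {ffun 'I_h -> {ffun 'I_M -> 'I_n}} :=
  [ffun i => [ffun a => W (i, a)]].
pose S := [set W : {ffun 'I_h * 'I_M -> 'I_n} | injectiveb W & blowup M Q (curry W)].
pose N := [set W : {ffun 'I_h * 'I_M -> 'I_n} | ~~ injectiveb W].
have SN : #|[set W | blowup M Q W]| <= #|S| + #|N|.
  pose unc (W : {ffun 'I_h -> {ffun 'I_M -> 'I_n}}) : {ffun 'I_h * 'I_M -> 'I_n} :=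
    [ffun x => W x.1 x.2].
  have uncK : cancel unc curry.
    by move=> W; apply/ffunP=> i; apply/ffunP=> a; rewrite !ffunE.
  rewrite -(card_imset _ (can_inj uncK)); apply: leq_trans (leq_card_setU _ _).
  apply/subset_leq_card/subsetP=> V /imsetP[W]; rewrite inE => bW ->.
  by rewrite !inE uncK bW andbT orbN.
have := card_noninjective ('I_h * 'I_M)%type 'I_n; rewrite card_prod !card_ord -/N => nN.
have nS : n ^ (h * M) <= 2 * E' * #|S|.
  have h1 : 2 * E' * #|N| <= n ^ (h * M).
    rewrite -(@leq_pmul2l ((h * M) ^ 2)) ?expn_gt0 ?hM0 //; apply: leq_trans nN.
    have ar a b c : c * (2 * b * a) = a * (2 * c * b) by lia.
    by rewrite ar leq_mul2l nE orbT.
  have h2 : n ^ (h * M) <= E' * (#|S| + #|N|).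
    by rewrite mulnC; apply: leq_trans bQ _; rewrite leq_mul2l SN orbT.
  by move: h1 h2; move: (n ^ _) => x; lia.
have SP t : t \in S -> t \in family (fun=> mem [set: 'I_n]) /\
    exists2 g : 'I_h -> 'I_h * 'I_M, injective g & `[< embedding H T [ffun x => t (g x)] >].
  rewrite inE => /andP[/injectiveP tI bt]; split; first by apply/familyP=> i; rewrite inE.
  have [g gI gE] := embedding_of_blowup tT tI bt; exists g => //.
  by apply/asboolP; apply: embedding_ext gE => x; rewrite ffunE.
have nF (d : 'I_h * 'I_M) : n <= #|[set: 'I_n]| by rewrite cardsT card_ord.
have := @sampling _ _ _ (fun=> setT) (fun f => `[< embedding H T f >]) S n nF SP.
rewrite prod_nat_const cardsT card_prod !card_ord -/(embeddings H T) => sam.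
have nhM : 0 < n ^ (h * M) by rewrite expn_gt0 n0.
have arith a b c d e x : c * b <= d * e * a -> a * b <= 2 * x * c * b ->
    b * a <= 2 * x * d * e * a.
  by move=> /(leq_mul (leqnn (2 * x))); lia.
rewrite -(leq_pmul2r nhM); apply: arith sam _.
exact: leq_mul nS (leqnn _).
Qed.

(** * Choice of parameters *)

(** For [q] at least 2 constant factors are absorbed into the exponent, giving the bare power that
    [eps ^+ d] requires. *)
Definition poly_bounded (f : nat -> nat) := exists d, forall q, 2 <= q -> f q <= q ^ d.

Lemma poly_bounded_const c : poly_bounded (fun=> c).
Proof.
exists c => q q2; apply: leq_trans (ltnW (ltn_expl c (isT : 1 < 2))) _.
exact: leq_exp_base.
Qed.

Lemma poly_bounded_id : poly_bounded id.
Proof. by exists 1 => q _; rewrite expn1. Qed.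

Lemma poly_boundedM f g : poly_bounded f -> poly_bounded g -> poly_bounded (fun q => f q * g q).
Proof.
move=> [d fd] [e ge]; exists (d + e) => q q2; rewrite expnD.
by apply: leq_mul; [apply: fd|apply: ge].
Qed.

Lemma poly_boundedD f g : poly_bounded f -> poly_bounded g -> poly_bounded (fun q => f q + g q).
Proof.
move=> [d fd] [e ge]; exists (d + e).+1 => q q2; have q0 := ltnW q2.
apply: (@leq_trans (2 * q ^ (d + e))); last by rewrite expnS leq_mul2r q2 orbT.
rewrite mul2n -addnn; apply: leq_add.
  by apply: leq_trans (fd q q2) _; rewrite leq_pexp2l ?leq_addr.
by apply: leq_trans (ge q q2) _; rewrite leq_pexp2l ?leq_addl.
Qed.

Lemma poly_boundedX f e : poly_bounded f -> poly_bounded (fun q => f q ^ e).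
Proof.
by move=> [d fd]; exists (d * e) => q q2; rewrite expnM; apply/leq_exp_base/fd.
Qed.

Lemma bernoulli_half q : 0 < q -> 2 * q.-1 ^ q <= q ^ q.
Proof.
case: q => // q _; rewrite -pred_Sn.
(* Bernoulli's inequality for [(1 + 1 / q) ^ e], cleared of denominators; [q] is now the
   predecessor. *)
have B e : q ^ e * (q + e) <= q.+1 ^ e * q.
  elim: e => [|e IH]; first by rewrite addn0.
  rewrite !expnS; have := leq_mul (leqnn q.+1) IH.
  by move: (q ^ e) (q.+1 ^ e) => x y; nia.
case: q B => [|q] B; first by rewrite exp0n.
rewrite -(@leq_pmul2r q.+1) //; apply: leq_trans (B _).
by rewrite -mulnA mulnCA leq_mul2l; apply/orP; right; lia.
Qed.

(* [s = 2 ^ (4 m + 6) q ^ 2] is where the decay [(1 - 1/q) ^ s] beats the square of the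
   Sauer-Shelah bound [p]. *)
Lemma sample_size m q (s := 2 ^ (4 * m + 6) * q ^ 2) (p := (s.+1 ^ m).+1) : 0 < q ->
  4 * p ^ 2 * q.-1 ^ s <= q ^ s.
Proof.
move=> q0; pose c := 2 ^ (4 * m + 6).
have s1 : s.+1 <= 2 ^ (4 * m + 7 + 2 * q).
  have -> : 4 * m + 7 + 2 * q = (4 * m + 6 + q * 2).+1 by lia.
  rewrite expnS expnD expnM -/c /s -/c.
  have c0 : 0 < c by rewrite expn_gt0.
  have qq : q ^ 2 <= (2 ^ q) ^ 2 by apply/leq_exp_base/ltnW/ltn_expl.
  have := leq_mul (leqnn c) qq.
  have : 0 < c * q ^ 2 by rewrite muln_gt0 c0 expn_gt0 q0.
  by move: (c * _) => x; lia.
(* Every [q] factors [1 - 1 / q] gain a factor 2, so the [c * q * q] test vertices gain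
   [2 ^ (c * q)]. *)
have p2 : 4 * p ^ 2 <= 2 ^ (c * q).
  have p1 : p <= 2 * s.+1 ^ m.
    by have : 0 < s.+1 ^ m; [rewrite expn_gt0|rewrite /p; lia].
  apply: (@leq_trans (4 * (2 * (2 ^ (4 * m + 7 + 2 * q)) ^ m) ^ 2)).
    rewrite leq_mul2l /=; apply/leq_exp_base/(leq_trans p1).
    by rewrite leq_mul2l /=; apply: leq_exp_base.
  rewrite -[4]/(2 ^ 2) -[X in (X * _) ^ 2]expn1 -!expnM -expnD -expnM -expnD leq_exp2l //.
  have c1 : 2 * (2 * m + 3) <= 2 ^ (2 * m + 3).
    rewrite [in leqRHS](_ : 2 * m + 3 = (2 * m + 2).+1); last lia.
    rewrite expnS leq_mul2l /=; have := ltn_expl (2 * m + 2) (isT : 1 < 2); lia.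
  have c2 : (2 * (2 * m + 3)) ^ 2 <= c.
    rewrite /c (_ : 4 * m + 6 = (2 * m + 3) * 2); last lia.
    by rewrite expnM; apply: leq_exp_base.
  have := leq_mul c2 (leqnn q); rewrite expnS expn1.
  by nia.
have -> : s = c * q * q by rewrite /s /c -mulnA mulnn.
rewrite [q.-1 ^ _]expnM.
have -> : q.-1 ^ (c * q) = (q.-1 ^ q) ^ c by rewrite mulnC expnM.
have -> : q ^ (c * q * q) = ((q ^ q) ^ c) ^ q by rewrite -!expnM; congr (_ ^ _); lia.
apply: leq_trans (leq_mul p2 (leqnn _)) _.
by rewrite expnM -!expnMn; apply/leq_exp_base/leq_exp_base/bernoulli_half.
Qed.

(** [L] is [n / k] up to a factor 2, so there are at most [2 * L] clusters, and [E] bounds the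
    inverse density given by [frequent_quotient]. *)
Lemma embeddings_of_clustering h n (H : rel 'I_h) (T : rel 'I_n) (P : {set {set 'I_n}}) q k L
    (E := 2 * (2 * L) ^ h * h ^ h * (2 * L) ^ h) :
  tournament T -> 0 < h -> 0 < n -> 0 < k -> trivIset P ->
  (forall B, B \in P -> #|B| = k /\ exists c, forall v, v \in B -> q * distance T c v < n) ->
  (forall T' : rel 'I_n, tournament T' -> H_free H T' -> 14 * n ^ 2 <= q * num_reversed T T') ->
  q * #|~: cover P| <= n -> 2 * h <= q -> q <= L -> k * L <= n -> n <= 2 * L * k ->
  2 * (h * 2 ^ h) ^ 2 * E ^ ((2 ^ h) ^ h) <= n ->
  n ^ h <= 2 * E ^ ((2 ^ h) ^ h) * (h * 2 ^ h) ^ h * #|embeddings H T|.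
Proof.
move=> tT h0 n0 k0 tP kP far qU hq qL kL nk nE.
have covP : #|cover P| = #|P| * k.
  have /eqP <- := tP; rewrite -sum_nat_const; apply: eq_bigr => B BP.
  by rewrite (kP B BP).1.
have covU : #|cover P| + #|~: cover P| = n by rewrite cardsC card_ord.
(* The clusters cover half of the vertices, so [2 * #|P|] is at least [L], hence at least
   [2 * h]. *)
have hP : h <= #|P|.
  have h1 : 2 * #|~: cover P| <= n.
    by apply: leq_trans qU; rewrite leq_mul2r; apply/orP; right; lia.
  have : k * L <= k * (2 * #|P|) by lia.
  by rewrite leq_pmul2l //; lia.
have [B0 B0P] : exists B, B \in P by apply/card_gt0P; lia.
pose I := {B : {set 'I_n} | B \in P}.
pose cls v : I := insubd (exist _ B0 B0P : I) (pblock P v).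
have cI : #|{: I}| = #|P| by rewrite card_sig; apply: eq_card.
have clsF (i : I) v : v \in val i -> cls v = i.
  move=> vi; apply: val_inj; rewrite val_insubd (def_pblock tP (valP i) vi).
  by rewrite (valP i).
have [|||||p pP] := @frequent_quotient h n H T I val cls q k tT clsF _ _ _ _ far h0 _ k0 n0.
- by move=> i; apply: (kP _ (valP i)).1.
- move=> i a b ai bi; have [_ [c cP]] := kP _ (valP i).
  have := distance_triangle T a b c; have := cP a ai; have := cP b bi.
  by move: (distance T c a) (distance T c b) (distance T a b) => x y z; nia.
- apply: leq_trans qU; rewrite leq_mul2l; apply/orP; right.
  apply/subset_leq_card/subsetP=> v; rewrite !inE; apply: contra => vP.
  by rewrite val_insubd pblock_mem // mem_pblock.
- by apply: leq_trans kL; rewrite mulnC leq_mul2l qL orbT.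
- by rewrite cI.
apply: (embeddings_of_quotient (p := p) tT h0 _ nE).
  by rewrite !muln_gt0 !expn_gt0 h0 muln_gt0; lia.
apply: leq_trans (leq_exp_base h nk) _; rewrite expnMn.
apply: leq_trans (leq_mul (leqnn _) pP) _.
have PL : #|P| <= 2 * L.
  by rewrite -(leq_pmul2r k0); apply: leq_trans nk; lia.
have arith a b c d : b <= a -> a * (2 * b * c * d) <= 2 * a * c * a * d.
  by move=> /(leq_mul (leqnn (a * c * d))); lia.
rewrite cI; apply: arith; exact: leq_exp_base.
Qed.

Lemma polynomially_many_embeddings h : 0 < h -> exists2 C, poly_bounded C &
  forall H : rel 'I_h, oriented H -> two_colorable H -> forall q, 2 * h <= q ->
  exists n0, forall n, n0 <= n -> forall T : rel 'I_n, tournament T ->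
  (forall T' : rel 'I_n, tournament T' -> H_free H T' -> 14 * n ^ 2 <= q * num_reversed T T') ->
  n ^ h <= C q * #|embeddings H T|.
Proof.
move=> h0.
pose m := #|{: {ffun 'I_h -> 'I_(2 ^ h)} * 'I_(2 ^ h).+1 * 'I_(2 ^ h) + 'I_(2 ^ h)}|.
pose s q := 2 ^ (4 * m + 6) * q ^ 2; pose p q := ((s q).+1 ^ m).+1.
(* With [k] about [n / L q], a sparse set of [n / q] vertices has at least [4 * p q ^ 2 * k] of
   them. *)
pose L q := 4 * p q ^ 2 * q.
pose E q := 2 * (2 * L q) ^ h * h ^ h * (2 * L q) ^ h.
pose C1 q := 2 * (q * (p q + s q)) ^ h.
pose C2 q := 2 * E q ^ ((2 ^ h) ^ h) * (h * 2 ^ h) ^ h.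
have PC := poly_bounded_const; have PM := @poly_boundedM; have PX := @poly_boundedX.
have PD := @poly_boundedD; have Pid := poly_bounded_id.
have Ps : poly_bounded s by apply: (PM) (PC _) _; apply: (PX _ 2 Pid).
have Pp : poly_bounded p.
  have [d pd] := PD _ _ (PX _ m (PD _ _ Ps (PC 1))) (PC 1).
  by exists d => q /pd; rewrite !addn1.
have PL : poly_bounded L.
  by apply: (PM _ _ _ Pid); apply: (PM _ _ (PC 4)); apply: (PX).
have PE : poly_bounded E.
  have P2L := PX _ h (PM _ _ (PC 2) PL).
  by apply: (PM _ _ _ P2L); apply: (PM _ _ _ (PC _)); apply: (PM _ _ (PC 2)).
exists (fun q => C1 q + C2 q).
  apply: (PD).
    by apply: (PM _ _ (PC 2)); apply: (PX); apply: (PM _ _ Pid); apply: (PD).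
  by apply: (PM _ _ _ (PC _)); apply: (PM _ _ (PC 2)); apply: (PX).
move=> H oH H2 q hq; have q0 : 0 < q by lia.
exists (L q + 2 * (h * 2 ^ h) ^ 2 * E q ^ ((2 ^ h) ^ h) + 1) => n nn0 T tT far.
have p0 : 0 < p q ^ 2 by rewrite expn_gt0.
have L0 : 0 < L q by rewrite /L; move: (p q ^ 2) p0 => x; nia.
have n0 : 0 < n by lia.
pose k := n %/ L q.
have kL : k * L q <= n by apply: leq_trunc_div.
have k0 : 0 < k by rewrite divn_gt0 //; lia.
have nk : n <= 2 * L q * k.
  by have := ltn_ceil n L0; rewrite -/k mulSn; have := leq_mul k0 (leqnn (L q)); lia.
have qL : q <= L q by rewrite /L leq_pmull // muln_gt0 p0.
have [P [tP kP Uk]] := maximal_clustering (fun v u => q * distance T v u < n) k0.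
have [Ubig|Usmall] := leqP n (q * #|~: cover P|).
  apply: (@leq_trans (C1 q * #|embeddings H T|)); last by rewrite leq_mul2r leq_addr orbT.
  apply: (@embeddings_of_sparse_set h n H T (~: cover P) q k (s q)) => //.
  - by case: #|_| Ubig => //; lia.
  - rewrite -(leq_pmul2l q0); apply: leq_trans Ubig; apply: leq_trans kL.
    by rewrite -/m -/(p q) /L; lia.
  - exact: sample_size.
  - by move=> v; apply/ltnW/Uk.
apply: (@leq_trans (C2 q * #|embeddings H T|)); last by rewrite leq_mul2r leq_addl orbT.
apply: (embeddings_of_clustering tT h0 n0 k0 tP kP far (ltnW Usmall) hq qL kL nk).
by rewrite -/(E q); lia.
Qed.

(** * From powers of [q] to powers of [eps] *)

Local Open Scope ring_scope.

Theorem theorem3p1 (R : realType) :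
  forall h : nat, (0 < h)%N ->
  exists (eps0 : R) (d : nat), 0 < eps0 /\
    forall H : rel 'I_h, oriented H -> two_colorable H ->
    forall eps : R, 0 < eps -> eps < eps0 ->
    exists n0 : nat, forall n : nat, (n0 <= n)%N ->
    forall T : rel 'I_n, tournament T -> eps_far H T eps ->
      eps ^+ d * (n%:R ^+ h) <= (num_copies H T)%:R.
Proof.
move=> h h0; have [C PC Cemb] := polynomially_many_embeddings h0.
have [d Cd] := poly_boundedM PC (poly_bounded_const (h ^ h)).
(* The 15 gives [q <= 14 / eps + 1 <= eps^-1 ^+ 2], the [h] gives [2 * h <= q]. As [q ^ d] is lost
   in the count, the exponent is [2 * d]. *)
pose b : R := (15 + h)%:R; have b0 : 0 < b by rewrite ltr0n.
exists b^-1, (2 * d)%N; split=> [|H oH H2 eps e0 eb]; first by rewrite invr_gt0.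
have b_eps : b < eps^-1 by rewrite -[b]invrK ltf_pV2 // posrE ?invr_gt0.
pose q := (Num.truncn (14 / eps)).+1.
have /andP[q1 q2] : (q.-1%:R <= 14 / eps < q%:R).
  by apply: truncn_itv; rewrite divr_ge0 // ltW.
have b15 : b = 15 + h%:R by rewrite /b natrD.
have h0' : 0 <= h%:R :> R by rewrite ler0n.
have hq : (2 * h <= q)%N.
  rewrite -(ler_nat R) natrM; apply: le_trans (ltW q2); lra.
have q_eps : q%:R <= eps^-1 ^+ 2.
  have -> : q%:R = q.-1%:R + 1 :> R by rewrite -natr1.
  have : 15 * eps^-1 <= eps^-1 ^+ 2 by rewrite expr2 ler_wpM2r ?invr_ge0; lra.
  lra.
have [n0 n0P] := Cemb H oH H2 q hq; exists n0 => n nn0 T tT far.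
have /(n0P n nn0 T tT) emb : forall T' : rel 'I_n, tournament T' -> H_free H T' ->
    (14 * n ^ 2 <= q * num_reversed T T')%N.
  move=> T' tT' T'H; rewrite -(ler_nat R) [leRHS]natrM [leLHS]natrM natrX.
  apply: le_trans (ler_wpM2l (ler0n _ q) (far T' tT' T'H)).
  rewrite [leRHS]mulrA ler_wpM2r ?exprn_ge0 ?ler0n //.
  by rewrite -ler_pdivrMr // ltW.
have cop : (n ^ h <= q ^ d * num_copies H T)%N.
  apply: leq_trans emb _; apply: leq_trans (leq_mul (leqnn _) (leq_embeddings_copies H T)) _.
  rewrite mulnCA mulnC leq_mul2r; apply/orP; right.
  by apply: Cd; lia.
have eq1 : eps ^+ (2 * d) * q%:R ^+ d <= 1.
  rewrite exprM -exprMn; apply: exprn_ile1.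
    by rewrite mulr_ge0 ?exprn_ge0 ?ler0n // ltW.
  by rewrite -ler_pdivlMl ?exprn_gt0 // mulr1 -exprVn.
apply: (@le_trans _ _ (eps ^+ (2 * d) * (q%:R ^+ d * (num_copies H T)%:R))).
  apply: ler_wpM2l; first by rewrite exprn_ge0 // ltW.
  by rewrite -!natrX -natrM ler_nat.
by rewrite mulrA ler_piMl ?ler0n.
Qed.
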